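(* Let $X$ be a non-reflexive right $M$-embedded operator space and let $Y$ be a closed subspace of $X$. Then both $Y$ and $X/Y$ are right $M$-embedded.
   Context: For an operator space $X$, the bidual $X^{**}$ carries its standard dual operator space structure and $i_X:X\to X^{**}$ is the canonical complete isometry. $C_2(X)$ denotes the space of columns of length 2 over $X$, as a subspace of $M_2(X)$. A complete left $M$-projection on an operator space $X$ is a linear idempotent $P:X\to X$ such that the map $X\to C_2(X)$, $x\mapsto \begin{bmatrix}P(x)\\ x-P(x)\end{bmatrix}$, is a complete isometry. A subspace $J\subset X$ is a right $M$-summand of $X$ if it is the range of a complete left $M$-projection on $X$. A closed subspace $J\subset X$ is a right $M$-ideal of $X$ if $J^{\perp\perp}$ is a right $M$-summand of $X^{**}$. An operator space $X$ is right $M$-embedded if $i_X(X)$ is a right $M$-ideal of $X^{**}$. Subspaces and quotients carry their usual operator space structures. *)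

(* Defs.v *)
(* The scalar field is R[i] for R : realType.

   Operator spaces are treated abstractly, by Ruan's axioms: the data is a
   complex vector space with a function on each matrix space M_n(X), and
   [operator_space] says that these functions are operator space norms and that
   X is complete.  Keeping the data apart from the axioms lets duals, subspaces
   and quotients be defined as data by the usual formulas. *)
From HB Require Import structures.
From mathcomp Require Import all_boot all_order all_algebra.
From mathcomp Require Import all_classical all_reals all_analysis.
From mathcomp Require Import generic_quotient ring_quotient.
From mathcomp Require Import complex mxtens.

Set Implicit Arguments.
Unset Strict Implicit.
Unset Printing Implicit Defensive.

Import Order.TTheory GRing.Theory Num.Theory.
Import numFieldNormedType.Exports.
Import ComplexField.Normc.

Local Open Scope classical_set_scope.
Local Open Scope ring_scope.
Local Open Scope complex_scope.

Section ComplexMatrixNorm.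
Context {R : realType}.

Definition l2norm n (v : 'cV[R[i]]_n) : R :=
  Num.sqrt (\sum_i normc (v i 0) ^+ 2).

Definition opnorm m n (A : 'M[R[i]]_(m, n)) : R :=
  sup [set l2norm (A *m v) | v in [set v : 'cV[R[i]]_n | l2norm v <= 1]].

End ComplexMatrixNorm.

(* The identification M_m(M_n(V)) = M_(mn)(V). *)
Definition mxflatten (V : Type) m n (A : 'M['M[V]_n]_m) : 'M[V]_(m * n) :=
  \matrix_(p, q) A (mxtens_unindex p).1 (mxtens_unindex q).1
                   (mxtens_unindex p).2 (mxtens_unindex q).2.

(* The product a x b of scalar matrices a, b with a matrix x over V; the
   library's *m requires entries in a ring. *)
Definition mxact (K : comNzRingType) (V : lmodType K) m n
    (a : 'M[K]_(m, n)) (x : 'M[V]_n) (b : 'M[K]_(n, m)) : 'M[V]_m :=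
  \matrix_(i, j) \sum_k \sum_l (a i k * b l j) *: x k l.

Record matNormed (R : realType) := MatNormed {
  mat_sort :> lmodType R[i];
  mxnorm : forall n, 'M[mat_sort]_n -> R }.

Arguments mxnorm {R} m {n} x : rename.

Section OperatorSpace.
Context {R : realType}.
Implicit Types X Y : matNormed R.

Definition vnorm X (x : X) : R := mxnorm X (const_mx x : 'M[X]_1).

Definition norm_cvg X (u : nat -> X) (l : X) : Prop :=
  (fun n => vnorm (u n - l)) @ \oo --> (0 : R).

Definition norm_cauchy X (u : nat -> X) : Prop :=
  forall e : R, 0 < e -> exists N, forall m n, (N <= m)%N -> (N <= n)%N ->
    vnorm (u m - u n) < e.

Definition norm_closed X (J : set X) : Prop :=
  forall (u : nat -> X) (l : X),
    (forall n, J (u n)) -> norm_cvg u l -> J l.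

Record operator_space X : Prop := OperatorSpace {
  mxnorm_eq0 : forall n (x : 'M[X]_n), mxnorm X x = 0 -> x = 0;
  mxnorm_triangle : forall n (x y : 'M[X]_n),
    mxnorm X (x + y) <= mxnorm X x + mxnorm X y;
  mxnormZ : forall n (a : R[i]) (x : 'M[X]_n),
    mxnorm X (map_mx ( *:%R a) x) = normc a * mxnorm X x;
  mxnorm_dsum : forall m n (x : 'M[X]_m) (y : 'M[X]_n),
    mxnorm X (block_mx x 0 0 y) = Num.max (mxnorm X x) (mxnorm X y);
  mxnorm_act : forall m n (a : 'M[R[i]]_(m, n)) (x : 'M[X]_n)
      (b : 'M[R[i]]_(n, m)),
    mxnorm X (mxact a x b) <= opnorm a * mxnorm X x * opnorm b;
  norm_complete : forall u : nat -> X, norm_cauchy u ->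
    exists l : X, norm_cvg u l }.

Definition complete_isometry X Y (T : X -> Y) : Prop :=
  forall n (x : 'M[X]_n), mxnorm Y (map_mx T x) = mxnorm X x.

End OperatorSpace.

Section Dual.
Context {R : realType} (X : matNormed R).

Definition bounded_functional : {pred X -> R[i]^o} := fun f =>
  `[< scalar f /\ exists M : R, forall x, normc (f x) <= M * vnorm x >].

Lemma bounded_functional_submod_closed : submod_closed bounded_functional.
Proof.
split=> [|a f g /asboolP[fl [M fM]] /asboolP[gl [N gN]]]; apply/asboolP; split.
- by move=> a x y /=; rewrite mulr0 addr0.
- by exists 0 => x; rewrite normc0 mul0r.
- move=> b x y; rewrite /= -[(a *: f + g) (b *: x + y)]/(a * f _ + g _).
  rewrite -[(a *: f + g) x]/(a * f x + g x) -[(a *: f + g) y]/(a * f y + g y).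
  by rewrite fl gl !mulrDr addrACA !mulrA [a * b]mulrC.
- exists (normc a * M + N) => x; rewrite -[(a *: f + g) x]/(a * f x + g x).
  apply: (le_trans (le_normcD _ _)); rewrite normcM mulrDl -mulrA.
  apply: lerD (gN x); apply: ler_wpM2l (fM x).
  by case: (a) => r s; exact: sqrtr_ge0.
Qed.

HB.instance Definition _ := GRing.isSubmodClosed.Build _ _ bounded_functional
  bounded_functional_submod_closed.

Record dual_sort := DualSort {
  dual_val :> X -> R[i]^o;
  dual_valP : dual_val \in bounded_functional }.

HB.instance Definition _ := [isSub for dual_val].
HB.instance Definition _ := [Choice of dual_sort by <:].
HB.instance Definition _ := [SubChoice_isSubLmodule of dual_sort by <:].

(* M_n(X^* ) = CB(X, M_n): the norm of [f_ij] is the supremum over m of the norms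
   of the maps M_m(X) -> M_m(M_n) = M_(mn) induced by x |-> [f_ij(x)].  This
   supremum is finite when X is an operator space. *)
Definition dual_mxnorm n (f : 'M[dual_sort]_n) : R :=
  sup [set r | exists m (x : 'M[X]_m), mxnorm X x <= 1 /\
    r = opnorm (mxflatten
          (map_mx (fun x0 : X => map_mx (fun g : dual_sort => g x0) f) x))].

Definition dual : matNormed R := MatNormed dual_mxnorm.

End Dual.

Section Subspaces.
Context {R : realType}.

Record linear_subspace (X : matNormed R) := Subspace {
  subspace_pred :> {pred X};
  subspaceP : submod_closed subspace_pred }.

HB.instance Definition _ (X : matNormed R) (Y : linear_subspace X) :=
  GRing.isSubmodClosed.Build _ _ (subspace_pred Y) (subspaceP Y).

Variables (X : matNormed R) (Y : linear_subspace X).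

Record sub_sort := SubSort {
  sub_val :> X;
  sub_valP : sub_val \in subspace_pred Y }.

HB.instance Definition _ := [isSub for sub_val].
HB.instance Definition _ := [Choice of sub_sort by <:].
HB.instance Definition _ := [SubChoice_isSubLmodule of sub_sort by <:].

Definition sub_space : matNormed R :=
  MatNormed (fun n (y : 'M[sub_sort]_n) => mxnorm X (map_mx sub_val y)).

Definition quot_sort : Type := Quotient.quot (subspace_pred Y).
HB.instance Definition _ := GRing.Zmodule.on quot_sort.

Definition quot_pi (x : X) : quot_sort :=
  (\pi_(Quotient.quot (subspace_pred Y)) x)%qT.

Definition quot_scale (a : R[i]) (z : quot_sort) : quot_sort :=
  quot_pi (a *: repr z).

Lemma quot_piP x y : quot_pi x = quot_pi y <-> x - y \in subspace_pred Y.
Proof. by rewrite Quotient.idealrBE; split=> [/eqP|/eqP]. Qed.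

Lemma quot_reprK z : quot_pi (repr z) = z.
Proof. exact: reprK. Qed.

Lemma quot_piD x y : quot_pi (x + y) = quot_pi x + quot_pi y.
Proof. exact: raddfD. Qed.

Lemma quot_scaleE a x : quot_scale a (quot_pi x) = quot_pi (a *: x).
Proof.
apply/quot_piP; rewrite -scalerBr; apply: rpredZ.
by apply/quot_piP; rewrite quot_reprK.
Qed.

Lemma quot_scalerA a b z : quot_scale a (quot_scale b z) = quot_scale (a * b) z.
Proof. by rewrite -(quot_reprK z) !quot_scaleE scalerA. Qed.

Lemma quot_scale1r : left_id 1 quot_scale.
Proof. by move=> z; rewrite -(quot_reprK z) quot_scaleE scale1r. Qed.

Lemma quot_scalerDr : right_distributive quot_scale +%R.
Proof.
move=> a z t; rewrite -(quot_reprK z) -(quot_reprK t) -quot_piD !quot_scaleE.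
by rewrite -quot_piD scalerDr.
Qed.

Lemma quot_scalerDl z : {morph quot_scale^~ z : a b / a + b}.
Proof.
by move=> a b /=; rewrite -(quot_reprK z) !quot_scaleE -quot_piD scalerDl.
Qed.

HB.instance Definition _ := GRing.Zmodule_isLmodule.Build R[i] quot_sort
  quot_scalerA quot_scale1r quot_scalerDr quot_scalerDl.

(* M_n(X/Y) = M_n(X)/M_n(Y) *)
Definition quot_space : matNormed R :=
  MatNormed (fun n (z : 'M[quot_sort]_n) =>
    inf [set mxnorm X x | x in [set x : 'M[X]_n | map_mx quot_pi x = z]]).

End Subspaces.

Section RightMIdeals.
Context {R : realType}.
Implicit Types X : matNormed R.

(* The column with entries p.1, p.2, as the first column of a matrix in M_2(X). *)
Definition col2_mx X (p : X * X) : 'M[X]_2 :=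
  \matrix_(i, j) if j == 0 then (if i == 0 then p.1 else p.2) else 0.

Definition C2 X : matNormed R :=
  @MatNormed R (X * X)%type
    (fun n z => mxnorm X (mxflatten (map_mx (@col2_mx X) z))).

Definition complete_left_M_projection X (P : {linear X -> X}) : Prop :=
  (forall x, P (P x) = P x) /\
  @complete_isometry R X (C2 X) (fun x => (P x, x - P x)).

Definition right_M_summand X (J : set X) : Prop :=
  exists P : {linear X -> X}, complete_left_M_projection P /\ J = range P.

Definition annihilator X (J : set X) : set (dual X) :=
  [set f : dual X | forall x, J x -> f x = 0].

Definition right_M_ideal X (J : set X) : Prop :=
  [/\ submod_closed (fun x => x \in J), norm_closed J &
      right_M_summand (annihilator (annihilator J))].

(* The range of the canonical map i_X, where i_X(x) is evaluation at x; when X is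
   an operator space every evaluation is a bounded functional on X^*. *)
Definition canonical_image X : set (dual (dual X)) :=
  [set F | exists x : X, forall f : dual X, F f = f x].

Definition reflexive_space X : Prop := canonical_image (X := X) = setT.

Definition right_M_embedded X : Prop :=
  operator_space X /\ right_M_ideal (canonical_image (X := X)).

End RightMIdeals.

(* Main.v *)
From HB Require Import structures.
Require Import Defs.
From mathcomp Require Import all_boot all_order all_algebra.
From mathcomp Require Import all_classical all_reals all_analysis.
From mathcomp Require Import complex mxtens spectral ring lra.

(** Whether X is right M-embedded can be tested on a single map that is given by a
    formula natural in X, and conditions on natural maps pass to subspaces and
    quotients.

    Let i_X : X -> X^** be the canonical map.  The map pi_X which restricts a
    functional on X^** to X and evaluates at the restriction is a projection of
    X^*** onto the copy of X^*, and its kernel is the annihilator of X.  Its adjoint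
    Q_X is therefore a completely contractive projection of X^**** whose range is
    the second annihilator of X ([range_canon_proj_adj]).  A complete left
    M-projection is the only contractive projection onto its range
    ([left_M_projection_unique]): the norm of a column is bounded by the square
    root of the sum of the squares, and a second contractive projection onto the
    same range would violate this bound far out along a line.  So X is right
    M-embedded if and only if Psi |-> (Q_X Psi, Psi - Q_X Psi) is a complete isometry
    into C_2(X^**** ) ([right_M_embeddedP]).

    The fourfold adjoint of a complete contraction T : X -> Y satisfies
    T^**** Q_X = Q_Y T^**** ([canon_proj_adj_natural]).  The adjoint of a complete
    quotient map is a complete isometry ([adj_quotient]), and the adjoint of a
    complete isometry is a complete quotient map ([adj_isometric]).  Hence the
    inclusion of Y yields a complete isometry Y^**** -> X^****, along which the
    criterion descends at once ([canon_isometry_sub]), and the projection onto X/Y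
    yields a complete quotient map X^**** -> (X/Y)^****, along which columns are
    lifted, corrected and pushed down again ([canon_isometry_quotient]).

    The analytic input is the Arveson-Wittstock extension theorem for maps into M_n
    ([dual_extension]), which says that adjoints of complete isometries are complete
    quotient maps.  A matrix f over X^* pairs with M_n(X), and its norm is at most K
    if and only if |<f, a x b>| <= K (|a|^2 + |b|^2) / 2 for scalar matrices a, b
    with Hilbert-Schmidt norms |a|, |b| and x in the unit ball of some M_m(X)
    ([dual_normP]).  So the norm of f is the norm dual to a trace-class norm on
    M_n(X), and extension is the Hahn-Banach theorem for that norm, once it is known
    to be the same whether it is computed in the subspace or in X
    ([trace_norm_isometric]). *)

Set Implicit Arguments.
Unset Strict Implicit.
Unset Printing Implicit Defensive.

Import Order.TTheory GRing.Theory Num.Theory.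
Import numFieldNormedType.Exports.
Import ComplexField.Normc.

Local Open Scope classical_set_scope.
Local Open Scope ring_scope.
Local Open Scope complex_scope.
Local Open Scope sesquilinear_scope.


(** * Hilbert-Schmidt norms and contractions of scalar matrices *)

Section HilbertSchmidt.
Context {R : realType}.
Local Notation C := R[i].

Lemma normc_ge0 (x : C) : 0 <= normc x.
Proof. by case: x => a b; exact: sqrtr_ge0. Qed.

Lemma normc_normr (x : C) : `|x| = (normc x)%:C.
Proof. by []. Qed.

Lemma normc_sum I (r : seq I) (F : I -> C) :
  normc (\sum_(i <- r) F i) <= \sum_(i <- r) normc (F i).
Proof.
elim/big_ind2: _ => [|x y z t hx hz|//]; first by rewrite normc0.
by apply: le_trans (le_normcD _ _) _; apply: lerD.
Qed.

Lemma normc_real (a : R) : 0 <= a -> normc a%:C = a.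
Proof. by move=> a0; rewrite /normc /= expr0n /= addr0 sqrtr_sqr ger0_norm. Qed.

Lemma normcJ (x : C) : normc (Num.conj x) = normc x.
Proof. by case: x => a b; rewrite /normc /= sqrrN. Qed.

Definition hs2 m n (A : 'M[C]_(m, n)) : R := \sum_i \sum_j normc (A i j) ^+ 2.

Lemma hs2_ge0 m n (A : 'M[C]_(m, n)) : 0 <= hs2 A.
Proof. by apply: sumr_ge0 => i _; apply: sumr_ge0 => j _; exact: sqr_ge0. Qed.

Lemma hs2_tr m n (A : 'M[C]_(m, n)) : hs2 A^T = hs2 A.
Proof.
by rewrite /hs2 exchange_big; apply: eq_bigr => i _; apply: eq_bigr => j _; rewrite mxE.
Qed.

Lemma hs2_conj m n (A : 'M[C]_(m, n)) : hs2 (map_mx Num.conj A) = hs2 A.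
Proof.
by apply: eq_bigr => i _; apply: eq_bigr => j _; rewrite mxE normcJ.
Qed.

Lemma hs2Z m n (a : C) (A : 'M[C]_(m, n)) : hs2 (a *: A) = normc a ^+ 2 * hs2 A.
Proof.
rewrite /hs2 mulr_sumr; apply: eq_bigr => i _; rewrite mulr_sumr; apply: eq_bigr => j _.
by rewrite mxE normcM exprMn.
Qed.

Lemma hs2_0 m n : hs2 (0 : 'M[C]_(m, n)) = 0.
Proof. by rewrite -(scale0r 0) hs2Z normc0 expr0n mul0r. Qed.

Lemma hs2_col m n (A : 'M[C]_(m, n)) : hs2 A = \sum_j hs2 (col j A).
Proof.
rewrite /hs2 exchange_big; apply: eq_bigr => i _; apply: eq_bigr => j _.
by rewrite big_ord1 mxE.
Qed.

Lemma hs2_row m n (A : 'M[C]_(m, n)) : hs2 A = \sum_i hs2 (row i A).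
Proof.
by apply: eq_bigr => i _; rewrite /hs2 big_ord1; apply: eq_bigr => j _; rewrite mxE.
Qed.

Lemma hs2_col_le m n (A : 'M[C]_(m, n)) j : hs2 (col j A) <= hs2 A.
Proof.
by rewrite [leRHS]hs2_col (bigD1 j) //= lerDl sumr_ge0 // => k _; exact: hs2_ge0.
Qed.

Lemma hs2_row_le m n (A : 'M[C]_(m, n)) i : hs2 (row i A) <= hs2 A.
Proof.
by rewrite [leRHS]hs2_row (bigD1 i) //= lerDl sumr_ge0 // => k _; exact: hs2_ge0.
Qed.

Lemma hs2_row_mx m n p (A : 'M[C]_(m, n)) (B : 'M[C]_(m, p)) :
  hs2 (row_mx A B) = hs2 A + hs2 B.
Proof.
rewrite /hs2 -big_split; apply: eq_bigr => i _; rewrite big_split_ord /=.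
by congr (_ + _); apply: eq_bigr => j _; rewrite ?row_mxEl ?row_mxEr.
Qed.

Lemma hs2_col_mx m n p (A : 'M[C]_(m, n)) (B : 'M[C]_(p, n)) :
  hs2 (col_mx A B) = hs2 A + hs2 B.
Proof. by rewrite -hs2_tr tr_col_mx hs2_row_mx !hs2_tr. Qed.

Lemma hs2_scalar n (a : C) : hs2 (a%:M : 'M[C]_n) = n%:R * normc a ^+ 2.
Proof.
rewrite /hs2 (eq_bigr (fun=> normc a ^+ 2)) => [|i _].
  by rewrite sumr_const card_ord mulr_natl.
rewrite (bigD1 i) //= mxE eqxx big1 ?addr0 // => j ji.
by rewrite mxE eq_sym (negbTE ji) mulr0n normc0 expr0n.
Qed.

Lemma hs2_eq0 m n (A : 'M[C]_(m, n)) : hs2 A <= 0 -> A = 0.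
Proof.
move=> A0; have {A0}/eqP : hs2 A = 0 by apply/eqP; rewrite eq_le A0 hs2_ge0.
rewrite psumr_eq0 => [/allP A0|i _]; last by apply: sumr_ge0 => j _; exact: sqr_ge0.
apply/matrixP => i j; have := A0 i (mem_index_enum i); rewrite /= psumr_eq0 => [|k _];
  last exact: sqr_ge0.
move=> /allP /(_ j (mem_index_enum j)) /=; rewrite sqrf_eq0 => /eqP h.
by rewrite mxE; exact: eq0_normc.
Qed.

Lemma hs2_trace m n (A : 'M[C]_(m, n)) : (hs2 A)%:C = \tr (A *m A ^t*).
Proof.
rewrite /hs2 rmorph_sum; apply: eq_bigr => i _; rewrite rmorph_sum mxE;
  apply: eq_bigr => j _.
by rewrite !mxE -normCK normc_normr rmorphXn.
Qed.

Lemma l2normE n (v : 'cV[C]_n) : l2norm v = Num.sqrt (hs2 v).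
Proof. by congr Num.sqrt; apply: eq_bigr => i _; rewrite big_ord1. Qed.

(** Products of Hilbert-Schmidt norms are bounded throughout by means of squares.
    Unlike the products, these means are additive over block decompositions. *)
Lemma amgm (x y : R) : x * y <= (x ^+ 2 + y ^+ 2) / 2%:R.
Proof.
have := sqr_ge0 (x - y); rewrite sqrrB ler_pdivlMr ?ltr0n // => h.
by rewrite -subr_ge0; apply: le_trans h _; rewrite le_eqVlt; apply/orP; left; apply/eqP;
  ring.
Qed.

Lemma normc_dot_le n (u v : 'cV[C]_n) :
  normc ((u^T *m v) 0 0) <= (hs2 u + hs2 v) / 2%:R.
Proof.
rewrite mxE; apply: le_trans (normc_sum _ _) _.
rewrite /hs2 -big_split mulr_suml; apply: ler_sum => i _; rewrite !big_ord1 mxE normcM.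
exact: amgm.
Qed.

Lemma dot_conj n (u : 'cV[C]_n) :
  ((map_mx Num.conj u)^T *m u) 0 0 = (hs2 u)%:C.
Proof.
rewrite mxE /hs2 rmorph_sum; apply: eq_bigr => i _.
by rewrite !mxE big_ord1 mulrC -normCK normc_normr rmorphXn.
Qed.

(** Operator norm at most one, said without a supremum. *)
Definition contr m n (a : 'M[C]_(m, n)) := forall v : 'cV_n, hs2 (a *m v) <= hs2 v.

(** Test a^T v against its own conjugate u: the pairing is at once the square
    norm of a^T v and the pairing of a u with v. *)
Lemma contr_tr m n (a : 'M[C]_(m, n)) : contr a -> contr a^T.
Proof.
move=> ca v; set w := a^T *m v; set u := map_mx Num.conj w.
have e : (u^T *m w) 0 0 = ((a *m u)^T *m v) 0 0.
  by rewrite /w trmx_mul mulmxA.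
have := normc_dot_le (a *m u) v.
rewrite -e dot_conj normc_real ?hs2_ge0 // => h.
have := ca u; rewrite hs2_conj => h2; move: h; rewrite ler_pdivlMr ?ltr0n //.
move: (hs2 w) (hs2 v) (hs2 _) h2 => x y z; lra.
Qed.

Lemma contr_conj m n (a : 'M[C]_(m, n)) : contr a -> contr (map_mx Num.conj a).
Proof.
move=> ca v; have -> : map_mx Num.conj a *m v = map_mx Num.conj (a *m map_mx Num.conj v).
  rewrite map_mxM -map_mx_comp; congr (_ *m _); apply/matrixP => i j.
  by rewrite !mxE /= conjCK.
by rewrite hs2_conj (le_trans (ca _)) // hs2_conj.
Qed.

Lemma contr_mull m n p (a : 'M[C]_(m, n)) (A : 'M[C]_(n, p)) : contr a ->
  hs2 (a *m A) <= hs2 A.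
Proof.
move=> ca; rewrite hs2_col [leRHS]hs2_col; apply: ler_sum => j _.
by rewrite colE -mulmxA -colE; exact: ca.
Qed.

Lemma contr_mulr m n p (a : 'M[C]_(n, m)) (A : 'M[C]_(p, n)) : contr a ->
  hs2 (A *m a) <= hs2 A.
Proof.
by move=> ca; rewrite -hs2_tr trmx_mul -[leRHS]hs2_tr contr_mull //; exact: contr_tr.
Qed.

Lemma opnorm_ge0 m n (a : 'M[C]_(m, n)) : 0 <= opnorm a.
Proof.
pose S := [set l2norm (a *m v) | v in [set v : 'cV[C]_n | l2norm v <= 1]].
have [hs|hs] := pselect (has_sup S); last by rewrite /opnorm sup_out.
by apply: ub_le_sup; [case: hs|exists 0; rewrite /= ?mulmx0 l2normE hs2_0 sqrtr0].
Qed.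

Lemma contr_opnorm m n (a : 'M[C]_(m, n)) : contr a -> opnorm a <= 1.
Proof.
move=> ca; apply: ge_sup.
  by exists (l2norm (a *m 0)), 0 => //=; rewrite l2normE hs2_0 sqrtr0.
move=> _ [v /= v1 <-]; apply: le_trans v1; rewrite !l2normE; exact/ler_wsqrtr/ca.
Qed.

(** An LQ decomposition of the row block [a, e 1] gives an invertible L with
    L L^* = a a^* + e^2; adjoining e makes L invertible, at a small cost in
    Hilbert-Schmidt norm. *)
Lemma lq_factor m n (a : 'M[C]_(n, m)) (e : R) : 0 < e ->
  exists L : 'M[C]_n, [/\ L \in unitmx, contr (invmx L *m a) &
    hs2 L = hs2 a + n%:R * e ^+ 2].
Proof.
move=> e0; set A : 'M[C]_(n, m + n) := row_mx a (e%:C)%:M.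
have le_n : (n <= m + n)%N by rewrite leq_addl.
have Aeq : e%:C \is a GRing.unit.
  by rewrite unitfE eq_complex /= eqxx andbT gt_eqF.
have Afree : row_free A.
  apply/row_freeP; exists (col_mx 0 (e%:C)^-1%:M).
  by rewrite mul_row_col mulmx0 add0r -scalar_mxM mulrV.
set W := schmidt A; have /unitarymxP WW : W \is unitarymx by exact: schmidt_unitarymx.
have /submxP[L AL] : (A <= W)%MS by exact: schmidt_sub.
have Lu : L \in unitmx.
  rewrite -row_free_unit /row_free eqn_leq rank_leq_row /=.
  by move: Afree; rewrite /row_free => /eqP {1}<-; rewrite AL mxrankM_maxl.
have AA : A *m A ^t* = L *m L ^t*.
  by rewrite AL trmx_mul map_mxM mulmxA -(mulmxA L) WW mulmx1.
exists L; split => //.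
- have WE : W = row_mx (invmx L *m a) (invmx L *m (e%:C)%:M).
    by rewrite -mul_mx_row -/A AL mulKmx.
  suff h : contr ((invmx L *m a) ^t*).
    have := contr_tr (contr_conj h); congr contr; apply/matrixP => i j.
    by rewrite !mxE conjCK.
  move=> v; have : hs2 (W ^t* *m v) = hs2 v.
    apply: (@complexI R); rewrite !hs2_trace trmx_mul map_mxM trmxCK.
    by rewrite mxtrace_mulC mulmxA -[_ *m W *m _]mulmxA WW mulmx1 mxtrace_mulC.
  rewrite WE tr_row_mx map_col_mx mul_col_mx hs2_col_mx => <-.
  by rewrite lerDl hs2_ge0.
- have -> : hs2 L = hs2 A by apply: (@complexI R); rewrite !hs2_trace AA.
  by rewrite hs2_row_mx hs2_scalar normc_real // ltW.
Qed.

End HilbertSchmidt.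

(** * Two-sided action of scalar matrices *)

Section MatrixAction.
Context {K : comNzRingType}.
Implicit Types V W : lmodType K.

Lemma mxact_comp V m n p (a : 'M[K]_(m, n)) (a' : 'M[K]_(n, p)) (x : 'M[V]_p)
    (b' : 'M[K]_(p, n)) (b : 'M[K]_(n, m)) :
  mxact a (mxact a' x b') b = mxact (a *m a') x (b' *m b).
Proof.
apply/matrixP => i j; rewrite !mxE.
transitivity (\sum_k \sum_l \sum_k' \sum_l' (a i k * a' k k' * (b' l' l * b l j)) *: x k'
  l').
  apply: eq_bigr => k _; apply: eq_bigr => l _; rewrite mxE scaler_sumr.
  apply: eq_bigr => k' _; rewrite scaler_sumr; apply: eq_bigr => l' _.
  by rewrite scalerA; congr (_ *: _); ring.
rewrite (eq_bigr _ (fun k _ => exchange_big _ _ _ _ _ _)) exchange_big /=.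
apply: eq_bigr => k' _.
transitivity (\sum_l' \sum_k \sum_l (a i k * a' k k' * (b' l' l * b l j)) *: x k' l').
  rewrite [RHS]exchange_big; apply: eq_bigr => k _; exact: exchange_big.
apply: eq_bigr => l' _; rewrite !mxE big_distrlr /= scaler_suml; apply: eq_bigr => k _.
by rewrite scaler_suml.
Qed.

Lemma map_mxact V W (T : {linear V -> W}) m n (a : 'M[K]_(m, n)) x b :
  map_mx T (mxact a x b) = mxact a (map_mx T x) b.
Proof.
apply/matrixP => i j; rewrite !mxE linear_sum; apply: eq_bigr => k _.
by rewrite linear_sum; apply: eq_bigr => l _; rewrite linearZ !mxE.
Qed.

Lemma mxact1 V n (x : 'M[V]_n) : mxact 1%:M x 1%:M = x.
Proof.
apply/matrixP => i j; rewrite mxE (bigD1 i) //= [X in _ + X]big1 => [|k ki].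
  rewrite addr0 (bigD1 j) //= big1 => [|l lj];
    first by rewrite !mxE !eqxx mulr1 scale1r addr0.
  by rewrite !mxE (negbTE lj) mulr0 scale0r.
by rewrite big1 // => l _; rewrite !mxE eq_sym (negbTE ki) mul0r scale0r.
Qed.

Lemma mxactZ V m n (c : K) (a : 'M[K]_(m, n)) (x : 'M[V]_n) b :
  mxact a (map_mx ( *:%R c) x) b = map_mx ( *:%R c) (mxact a x b).
Proof.
apply/matrixP => i j; rewrite !mxE scaler_sumr; apply: eq_bigr => k _.
by rewrite scaler_sumr; apply: eq_bigr => l _; rewrite mxE !scalerA mulrC.
Qed.

Lemma mxactZl V m n (c : K) (a : 'M[K]_(m, n)) (x : 'M[V]_n) b :
  mxact (c *: a) x b = map_mx ( *:%R c) (mxact a x b).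
Proof.
apply/matrixP => i j; rewrite !mxE scaler_sumr; apply: eq_bigr => k _.
by rewrite scaler_sumr; apply: eq_bigr => l _; rewrite mxE scalerA mulrA.
Qed.

Lemma mxactZr V m n (c : K) (a : 'M[K]_(m, n)) (x : 'M[V]_n) b :
  mxact a x (c *: b) = map_mx ( *:%R c) (mxact a x b).
Proof.
apply/matrixP => i j; rewrite !mxE scaler_sumr; apply: eq_bigr => k _.
by rewrite scaler_sumr; apply: eq_bigr => l _; rewrite mxE scalerA mulrCA.
Qed.

Lemma mxact_block V m n p (a : 'M[K]_(m, n)) (a' : 'M[K]_(m, p)) (x : 'M[V]_n) (y : 'M[V]_p)
    (b : 'M[K]_(n, m)) (b' : 'M[K]_(p, m)) :
  mxact (row_mx a a') (block_mx x 0 0 y) (col_mx b b') = mxact a x b + mxact a' y b'.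
Proof.
apply/matrixP => i j; rewrite !mxE big_split_ord /=; congr (_ + _); apply: eq_bigr => k _.
  rewrite big_split_ord /= [X in _ + X]big1 => [|l _].
    rewrite addr0; apply: eq_bigr => l _.
    by rewrite row_mxEl col_mxEu block_mxEul.
  by rewrite block_mxEur [X in _ *: X]mxE scaler0.
rewrite big_split_ord /= [X in X + _]big1 => [|l _].
  rewrite add0r; apply: eq_bigr => l _.
  by rewrite row_mxEr col_mxEd block_mxEdr.
by rewrite block_mxEdl [X in _ *: X]mxE scaler0.
Qed.

Lemma mxact_entry V n (x : 'M[V]_n) m (a : 'M[K]_(m, n)) b i j :
  const_mx (mxact a x b i j) = mxact (row i a) x (col j b) :> 'M[V]_1.
Proof.
apply/matrixP => i' j'; rewrite !mxE; apply: eq_bigr => k _; apply: eq_bigr => l _.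
by rewrite !mxE.
Qed.

End MatrixAction.

(** * Matrix norms with Ruan's axioms *)

Section Ruan.
Context {R : realType}.
Local Notation C := R[i].
Implicit Types X Y : matNormed R.

(** The part of Ruan's axioms that passes to duals, where the norm is a supremum
    and completeness is a separate matter.  The last axiom speaks of contractions
    only, so that operator norms never have to be computed. *)
Record ruan X : Prop := Ruan {
  ruan_ge0 : forall n (x : 'M[X]_n), 0 <= mxnorm X x;
  ruanD : forall n (x y : 'M[X]_n), mxnorm X (x + y) <= mxnorm X x + mxnorm X y;
  ruanZ : forall n (a : C) (x : 'M[X]_n),
    mxnorm X (map_mx ( *:%R a) x) <= normc a * mxnorm X x;
  ruan_dsum : forall m n (x : 'M[X]_m) (y : 'M[X]_n),
    mxnorm X (block_mx x 0 0 y) <= Num.max (mxnorm X x) (mxnorm X y);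
  ruan_act : forall m n (a : 'M[C]_(m, n)) (x : 'M[X]_n) (b : 'M[C]_(n, m)),
    contr a -> contr b -> mxnorm X (mxact a x b) <= mxnorm X x }.

Lemma map_mx_scale0 (V : lmodType C) m n (x : 'M[V]_(m, n)) : map_mx ( *:%R 0) x = 0.
Proof. by apply/matrixP => i j; rewrite !mxE scale0r. Qed.

Lemma map_mx_scaleA (V : lmodType C) m n (a b : C) (x : 'M[V]_(m, n)) :
  map_mx ( *:%R a) (map_mx ( *:%R b) x) = map_mx ( *:%R (a * b)) x.
Proof. by apply/matrixP => i j; rewrite !mxE scalerA. Qed.

Lemma map_mx_scale1 (V : lmodType C) m n (x : 'M[V]_(m, n)) : map_mx ( *:%R 1) x = x.
Proof. by apply/matrixP => i j; rewrite !mxE scale1r. Qed.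

Lemma operator_space_ruan X : operator_space X -> ruan X.
Proof.
move=> oX.
have n0 n : mxnorm X (0 : 'M[X]_n) = 0.
  by rewrite -(map_mx_scale0 (0 : 'M[X]_n)) mxnormZ // normc0 mul0r.
have ge0 n (x : 'M[X]_n) : 0 <= mxnorm X x.
  have := mxnorm_triangle oX x (map_mx ( *:%R (-1)) x).
  have -> : x + map_mx ( *:%R (-1)) x = 0.
    by apply/matrixP => i j; rewrite !mxE scaleN1r subrr.
  rewrite n0 mxnormZ // normcN normc1 mul1r; move: (mxnorm _ _) => t; lra.
split => //.
- by move=> n x y; exact: mxnorm_triangle.
- by move=> n a x; rewrite mxnormZ.
- by move=> m n x y; rewrite mxnorm_dsum.
- move=> m n a x b ca cb; apply: le_trans (mxnorm_act _ _ _ _) _ => //.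
  rewrite -[leRHS]mulr1; apply: ler_pM => //;
    rewrite ?contr_opnorm ?mulr_ge0 ?opnorm_ge0 //.
  by rewrite -[leRHS]mul1r ler_wpM2r ?contr_opnorm.
Qed.

Section RuanTheory.
Variable X : matNormed R.
Hypothesis rX : ruan X.

Lemma ruan_norm0 n : mxnorm X (0 : 'M[X]_n) = 0.
Proof.
apply/eqP; rewrite eq_le ruan_ge0 // andbT -(map_mx_scale0 (0 : 'M[X]_n)).
by apply: le_trans (ruanZ rX _ _) _; rewrite normc0 mul0r.
Qed.

Lemma ruan_normZ n (a : C) (x : 'M[X]_n) :
  mxnorm X (map_mx ( *:%R a) x) = normc a * mxnorm X x.
Proof.
have [->|a0] := eqVneq a 0; first by rewrite map_mx_scale0 ruan_norm0 normc0 mul0r.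
have na : 0 < normc a.
  by rewrite lt_neqAle normc_ge0 andbT; apply: contra a0 => /eqP/esym/eq0_normc ->.
apply/eqP; rewrite eq_le ruanZ //= -ler_pdivlMl // -normcV.
rewrite -{1}(map_mx_scale1 x) -(mulVf a0) -map_mx_scaleA; exact: ruanZ.
Qed.

(** Divide x by numbers slightly above its norm and pass to the limit, which also
    covers matrices of norm zero. *)
Lemma ruan_homog n (x : 'M[X]_n) (F : 'M[X]_n -> R) (K : R) :
  (forall a y, F (map_mx ( *:%R a) y) = normc a * F y) ->
  (forall y, mxnorm X y <= 1 -> F y <= K) -> F x <= K * mxnorm X x.
Proof.
move=> FZ FK; have K0 : 0 <= K.
  apply: le_trans (FK 0 _); last by rewrite ruan_norm0 ler01.
  by rewrite -(map_mx_scale0 (0 : 'M[X]_n)) FZ normc0 mul0r.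
apply/ler_addgt0Pr => e e0.
pose c := mxnorm X x + e / (K + 1).
have c0 : 0 < c by rewrite ltr_wpDl ?ruan_ge0 // divr_gt0 // ltr_wpDl.
have h : F x <= K * c.
  rewrite mulrC -ler_pdivrMl // -(normc_real (ltW c0)) -normcV -FZ; apply: FK.
  rewrite ruan_normZ normcV (normc_real (ltW c0)) ler_pdivrMl // mulr1 lerDl.
  by rewrite ltW // divr_gt0 // ltr_wpDl.
apply: le_trans h _; rewrite mulrDr lerD2l mulrCA ger_pMr // ler_pdivrMr ?mul1r ?lerDl //.
by rewrite ltr_wpDl.
Qed.

End RuanTheory.
End Ruan.

(** * The trace pairing of a space with its dual *)

Section Dual.
Context {R : realType}.
Local Notation C := R[i].
Implicit Types X : matNormed R.

Section Functional.
Variable X : matNormed R.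
Implicit Types f g : dual X.

Lemma dual_linear_subproof f : linear (dual_val f).
Proof. by have /asboolP[fl _] := dual_valP f => a x y; exact: fl. Qed.

HB.instance Definition _ f :=
  GRing.isLinear.Build C X C^o _ (dual_val f) (dual_linear_subproof f).

(** Evaluation with values in [R[i]] rather than in the regular module [R[i]^o],
    so that scalars act by the ring product. *)
Definition dapp f (x : X) : C := dual_val f x.

Lemma dappDr f x y : dapp f (x + y) = dapp f x + dapp f y.
Proof. exact: linearD. Qed.
Lemma dappBr f x y : dapp f (x - y) = dapp f x - dapp f y.
Proof. exact: linearB. Qed.
Lemma dappZr f (a : C) x : dapp f (a *: x) = a * dapp f x.
Proof. exact: linearZZ. Qed.
Lemma dapp_sumr f I (r : seq I) (F : I -> X) :
  dapp f (\sum_(i <- r) F i) = \sum_(i <- r) dapp f (F i).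
Proof. exact: linear_sum. Qed.
Lemma dapp0r f : dapp f 0 = 0. Proof. exact: linear0. Qed.
Lemma dappDl f g x : dapp (f + g) x = dapp f x + dapp g x.
Proof. by []. Qed.
Lemma dappBl f g x : dapp (f - g) x = dapp f x - dapp g x.
Proof. by []. Qed.
Lemma dappZl f (a : C) x : dapp (a *: f) x = a * dapp f x.
Proof. by []. Qed.
Lemma dapp0l x : dapp (0 : dual X) x = 0.
Proof. by []. Qed.
Lemma dapp_suml I (r : seq I) (F : I -> dual X) x :
  dapp (\sum_(i <- r) F i) x = \sum_(i <- r) dapp (F i) x.
Proof. by elim/big_rec2: _ => [//|i _ g _ <-]; rewrite dappDl. Qed.

Lemma dual_ext f g : (forall x, dapp f x = dapp g x) -> f = g.
Proof. by move=> fg; apply: val_inj; apply/funext => x; exact: fg. Qed.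

Lemma dual_bounded (rX : ruan X) f :
  exists2 M : R, 0 <= M & forall x, normc (dapp f x) <= M * vnorm x.
Proof.
have /asboolP[_ [M fM]] := dual_valP f; exists `|M| => // x.
by apply: le_trans (fM x) _; apply: ler_wpM2r; [exact: ruan_ge0|exact: ler_norm].
Qed.

End Functional.

Section Pairing.
Variable X : matNormed R.

(** The trace pairing of M_n(X^* ) with M_n(X). *)
Definition pair n (f : 'M[dual X]_n) (z : 'M[X]_n) : C :=
  \sum_i \sum_j dapp (f i j) (z i j).

Lemma pairDl n (f g : 'M[dual X]_n) z : pair (f + g) z = pair f z + pair g z.
Proof.
rewrite /pair -big_split; apply: eq_bigr => i _; rewrite -big_split; apply: eq_bigr => j _.
by rewrite mxE.
Qed.

Lemma pairDr n (f : 'M[dual X]_n) y z : pair f (y + z) = pair f y + pair f z.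
Proof.
rewrite /pair -big_split; apply: eq_bigr => i _; rewrite -big_split; apply: eq_bigr => j _.
by rewrite mxE dappDr.
Qed.

Lemma pairZl n a (f : 'M[dual X]_n) z : pair (map_mx ( *:%R a) f) z = a * pair f z.
Proof.
rewrite /pair mulr_sumr; apply: eq_bigr => i _; rewrite mulr_sumr; apply: eq_bigr => j _.
by rewrite mxE dappZl.
Qed.

Lemma pairZr n a (f : 'M[dual X]_n) z : pair f (map_mx ( *:%R a) z) = a * pair f z.
Proof.
rewrite /pair mulr_sumr; apply: eq_bigr => i _; rewrite mulr_sumr; apply: eq_bigr => j _.
by rewrite mxE dappZr.
Qed.

Lemma pair_act m n (f : 'M[dual X]_n) (a : 'M[C]_(n, m)) z b :
  pair f (mxact a z b) = pair (mxact a^T f b^T) z.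
Proof.
rewrite /pair.
transitivity (\sum_i \sum_j \sum_k \sum_l a i k * b l j * dapp (f i j) (z k l)).
  apply: eq_bigr => i _; apply: eq_bigr => j _; rewrite mxE dapp_sumr;
    apply: eq_bigr => k _.
  by rewrite dapp_sumr; apply: eq_bigr => l _; rewrite dappZr.
rewrite (eq_bigr _ (fun k _ => exchange_big _ _ _ _ _ _)) exchange_big /=.
apply: eq_bigr => k _.
transitivity (\sum_l \sum_i \sum_j a i k * b l j * dapp (f i j) (z k l)).
  rewrite [RHS]exchange_big; apply: eq_bigr => i _; exact: exchange_big.
apply: eq_bigr => l _; rewrite mxE dapp_suml; apply: eq_bigr => i _.
by rewrite dapp_suml; apply: eq_bigr => j _; rewrite dappZl !mxE.
Qed.

Lemma pair_dsum m n (f : 'M[dual X]_m) (g : 'M[dual X]_n) (z : 'M[X]_(m + n)) :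
  pair (block_mx f 0 0 g) z = pair f (ulsubmx z) + pair g (drsubmx z).
Proof.
rewrite /pair big_split_ord; congr (_ + _); apply: eq_bigr => i _; rewrite big_split_ord /=.
  rewrite [X in _ + X]big1 => [|j _]; last by rewrite block_mxEur [X in dapp X _]mxE dapp0l.
  by rewrite addr0; apply: eq_bigr => j _; rewrite block_mxEul !mxE.
rewrite [X in X + _]big1 => [|j _]; last by rewrite block_mxEdl [X in dapp X _]mxE dapp0l.
by rewrite add0r; apply: eq_bigr => j _; rewrite block_mxEdr !mxE.
Qed.

Lemma pair_const (f : dual X) (z : 'M[X]_1) : pair (const_mx f) z = dapp f (z 0 0).
Proof. by rewrite /pair !big_ord1 mxE. Qed.

(** Complete boundedness by K, tested on the products a x b.  Rescaling a and b turns
    the mean of squares into the product of the Hilbert-Schmidt norms. *)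
Definition dual_bound n (f : 'M[dual X]_n) (K : R) : Prop :=
  forall m (a : 'M[C]_(n, m)) (x : 'M[X]_m) (b : 'M[C]_(m, n)), mxnorm X x <= 1 ->
  normc (pair f (mxact a x b)) <= K * ((hs2 a + hs2 b) / 2%:R).

(** The matrix f_m(x) acts on columns indexed by pairs; reading such columns
    as m x n matrices turns its bilinear form into the trace pairing. *)
Definition vec m n (v : 'M[C]_(m, n)) : 'cV[C]_(m * n) :=
  \col_p v (mxtens_unindex p).1 (mxtens_unindex p).2.
Definition unvec m n (v : 'cV[C]_(m * n)) : 'M[C]_(m, n) :=
  \matrix_(i, j) v (mxtens_index (i, j)) 0.

Lemma unvecK m n : cancel (@unvec m n) (@vec m n).
Proof.
move=> v; apply/matrixP => i j; rewrite !mxE ord1; congr (v _ _).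
by rewrite -[RHS]mxtens_unindexK; congr mxtens_index; case: (mxtens_unindex i).
Qed.

Lemma sum_mxtens (V : nmodType) m n (F : 'I_m -> 'I_n -> V) :
  \sum_(p < m * n) F (mxtens_unindex p).1 (mxtens_unindex p).2 = \sum_i \sum_j F i j.
Proof.
rewrite pair_bigA (reindex (@mxtens_index m n)).
  by apply: eq_bigr => p _; rewrite mxtens_indexK.
by exists (@mxtens_unindex m n) => p _; rewrite ?mxtens_indexK ?mxtens_unindexK.
Qed.

Lemma hs2_vec m n (v : 'M[C]_(m, n)) : hs2 (vec v) = hs2 v.
Proof.
by rewrite /hs2 -(sum_mxtens (fun i j => normc (v i j) ^+ 2)); apply: eq_bigr => p _;
  rewrite big_ord1 mxE.
Qed.

Lemma hs2_unvec m n (v : 'cV[C]_(m * n)) : hs2 (unvec v) = hs2 v.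
Proof. by rewrite -[in RHS](unvecK v) hs2_vec. Qed.

Definition amplify m n (f : 'M[dual X]_n) (x : 'M[X]_m) : 'M[C]_(m * n) :=
  mxflatten (map_mx (fun x0 : X => map_mx (fun g : dual X => g x0 : C) f) x).

Lemma amplify_pair m n (f : 'M[dual X]_n) (x : 'M[X]_m) u v :
  ((vec u)^T *m (amplify f x *m vec v)) 0 0 = pair f (mxact u^T x v).
Proof.
rewrite pair_act trmxK.
transitivity (\sum_k \sum_i \sum_l \sum_j u k i * v l j * dapp (f i j) (x k l)).
  rewrite mxE.
  rewrite -(sum_mxtens (fun k i => \sum_l \sum_j u k i * v l j * dapp (f i j) (x k l))).
  apply: eq_bigr => p _; rewrite !mxE mulr_sumr.
  rewrite -(sum_mxtens (fun l j => u (mxtens_unindex p).1 (mxtens_unindex p).2 *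
    v l j * dapp (f (mxtens_unindex p).2 j) (x (mxtens_unindex p).1 l))).
  by apply: eq_bigr => q _; rewrite !mxE mulrCA mulrC.
rewrite /pair; apply: eq_bigr => k _; rewrite exchange_big; apply: eq_bigr => l _.
rewrite mxE dapp_suml; apply: eq_bigr => i _; rewrite dapp_suml; apply: eq_bigr => j _.
by rewrite mxE dappZl.
Qed.

End Pairing.
End Dual.

(** * Dual norms satisfy Ruan's axioms *)

Section DualNorm.
Context {R : realType}.
Local Notation C := R[i].

(** The mean inequality for u and the best multiple of v. *)
Lemma cauchy_schwarz n (u v : 'cV[C]_n) :
  normc ((u^T *m v) 0 0) ^+ 2 <= hs2 u * hs2 v.
Proof.
set d := normc _; have [v0|v0] := eqVneq (hs2 v) 0.
  have v00 : v = 0 by apply: hs2_eq0; rewrite v0.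
  by rewrite /d v00 mulmx0 mxE normc0 expr0n mulr_ge0 ?hs2_ge0.
have vp : 0 < hs2 v by rewrite lt_neqAle eq_sym v0 hs2_ge0.
have s0 : 0 <= d / hs2 v by rewrite divr_ge0 ?normc_ge0 ?hs2_ge0.
have := normc_dot_le u ((d / hs2 v)%:C *: v).
rewrite hs2Z normc_real // -scalemxAr mxE normcM normc_real // -/d.
rewrite -(ler_pM2r vp) => h.
have e : (hs2 u + (d / hs2 v) ^+ 2 * hs2 v) / 2%:R * hs2 v =
    (hs2 u * hs2 v + d ^+ 2) / 2%:R.
  by field.
move: h; rewrite e; have -> : d / hs2 v * d * hs2 v = d ^+ 2 by field.
by move: (hs2 u * hs2 v) (d ^+ 2) => p q; lra.
Qed.

Lemma hs2_contr m n (a : 'M[C]_(m, n)) : hs2 a <= 1 -> contr a.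
Proof.
move=> a1 v; apply: (@le_trans _ _ (hs2 a * hs2 v)); last first.
  by rewrite -[leRHS]mul1r ler_wpM2r ?hs2_ge0.
rewrite (hs2_row a) mulr_suml /hs2; apply: ler_sum => i _; rewrite big_ord1.
have := cauchy_schwarz (row i a)^T v; rewrite trmxK hs2_tr.
by rewrite -row_mul mxE.
Qed.

Section NormFormula.
Variable X : matNormed R.
Hypothesis rX : ruan X.

Lemma ruan_act_hs2 m n (a : 'M[C]_(m, n)) (x : 'M[X]_n) b : mxnorm X x <= 1 ->
  mxnorm X (mxact a x b) <= (hs2 a + hs2 b) / 2%:R.
Proof.
move=> x1.
have unscale k l (c : 'M[C]_(k, l)) :
  exists c', contr c' /\ c = (Num.sqrt (hs2 c))%:C *: c'.
  have [c0|c0] := eqVneq (hs2 c) 0.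
    have -> : c = 0 by apply: hs2_eq0; rewrite c0.
    by exists 0; rewrite scaler0; split => // v; rewrite mul0mx hs2_0 hs2_ge0.
  have cp : 0 < hs2 c by rewrite lt_neqAle eq_sym c0 hs2_ge0.
  have sp : Num.sqrt (hs2 c) != 0 by rewrite gt_eqF // sqrtr_gt0.
  exists (((Num.sqrt (hs2 c))%:C)^-1 *: c); split.
    apply: hs2_contr;
      rewrite hs2Z normcV normc_real ?sqrtr_ge0 // exprVn sqr_sqrtr ?hs2_ge0 //.
    by rewrite mulVf.
  by rewrite scalerA mulfV ?scale1r // eq_complex /= eqxx andbT.
have [a' [ca ea]] := unscale _ _ a; have [b' [cb eb]] := unscale _ _ b.
have := amgm (Num.sqrt (hs2 a)) (Num.sqrt (hs2 b)).
rewrite !sqr_sqrtr ?hs2_ge0 //; apply: le_trans.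
rewrite {1}ea {1}eb mxactZl mxactZr !ruan_normZ // !normc_real ?sqrtr_ge0 //.
rewrite ler_wpM2l ?sqrtr_ge0 // -[leRHS]mulr1 ler_wpM2l ?sqrtr_ge0 //.
by apply: le_trans x1; exact: ruan_act.
Qed.

(** Bounded functionals are completely bounded: every entry of a x b is a product
    of x with a row and a column.  Hence the supremum that defines the dual norm
    is finite. *)
Lemma dual_bound_exists n (f : 'M[dual X]_n) : exists2 K, 0 <= K & dual_bound f K.
Proof.
have h i j := dual_bounded rX (f i j).
pose M i j := sval (cid2 (h i j)).
have M0 i j : 0 <= M i j by rewrite /M; case: cid2.
have fM i j x : normc (dapp (f i j) x) <= M i j * vnorm x by rewrite /M; case: cid2.
exists (\sum_i \sum_j M i j) => [|m a x b x1].
  by apply: sumr_ge0 => i _; apply: sumr_ge0.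
rewrite mulr_suml; apply: le_trans (normc_sum _ _) _; apply: ler_sum => i _.
rewrite mulr_suml; apply: le_trans (normc_sum _ _) _; apply: ler_sum => j _.
apply: le_trans (fM i j _) _; rewrite ler_wpM2l // /vnorm mxact_entry.
apply: le_trans (ruan_act_hs2 _ _ x1) _; rewrite ler_pM2r ?invr_gt0 ?ltr0n //.
by apply: lerD; rewrite ?hs2_row_le ?hs2_col_le.
Qed.

Lemma amplify_le m n (f : 'M[dual X]_n) (x : 'M[X]_m) K v : 0 <= K -> dual_bound f K ->
  mxnorm X x <= 1 -> l2norm v <= 1 -> l2norm (amplify f x *m v) <= K.
Proof.
move=> K0 fK x1 v1; set w := amplify f x *m v.
have [w0|w0] := eqVneq (l2norm w) 0; first by rewrite w0.
have wp : 0 < l2norm w by rewrite lt_neqAle eq_sym w0 sqrtr_ge0.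
have wE : hs2 w = l2norm w ^+ 2 by rewrite l2normE sqr_sqrtr ?hs2_ge0.
have vE : hs2 v <= 1.
  by rewrite -(sqr_sqrtr (hs2_ge0 v)) -l2normE exprn_ile1 // sqrtr_ge0.
have li0 : 0 <= (l2norm w)^-1 by rewrite invr_ge0 ltW.
(* The unit vector whose pairing with w is the length of w. *)
pose u : 'cV[C]_(m * n) := (l2norm w)^-1%:C *: map_mx Num.conj w.
have u1 : hs2 u = 1.
  by rewrite hs2Z hs2_conj wE normc_real // -exprMn mulVf // expr1n.
have := fK _ (unvec u)^T x (unvec v) x1.
rewrite -amplify_pair !unvecK hs2_tr !hs2_unvec u1 -/w.
have -> : (u^T *m w) 0 0 = (l2norm w)%:C.
  rewrite /u linearZ /= -scalemxAl mxE dot_conj wE -rmorphM; congr _%:C.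
  by rewrite expr2 mulrA mulVf // mul1r.
rewrite normc_real ?sqrtr_ge0 // => h; apply: le_trans h _.
by rewrite -[leRHS]mulr1 ler_wpM2l // ler_pdivrMr ?ltr0n // mul1r; move: vE; lra.
Qed.

Lemma l2norm0 n : l2norm (0 : 'cV[C]_n) = 0.
Proof. by rewrite l2normE hs2_0 sqrtr0. Qed.

Lemma dual_bound_amplify m n (f : 'M[dual X]_n) (x : 'M[X]_m) K :
  0 <= K -> dual_bound f K ->
  mxnorm X x <= 1 -> opnorm (amplify f x) <= K.
Proof.
move=> K0 fK x1; apply: ge_sup.
  by exists (l2norm (amplify f x *m 0)), 0 => //=; rewrite l2norm0.
by move=> _ [v /= v1 <-]; exact: amplify_le.
Qed.

Lemma dual_norm_le n (f : 'M[dual X]_n) K :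
  0 <= K -> dual_bound f K -> mxnorm (dual X) f <= K.
Proof.
move=> K0 fK; apply: ge_sup.
  by exists (opnorm (amplify f (0 : 'M[X]_0))), 0, 0; rewrite ruan_norm0.
by move=> _ [m [x [x1 ->]]]; exact: dual_bound_amplify.
Qed.

Lemma opnorm_amplify_le m n (f : 'M[dual X]_n) (x : 'M[X]_m) : mxnorm X x <= 1 ->
  opnorm (amplify f x) <= mxnorm (dual X) f.
Proof.
move=> x1; apply: ub_le_sup; last by exists m, x.
have [K K0 fK] := dual_bound_exists f.
by exists K => _ [k [y [y1 ->]]]; exact: dual_bound_amplify.
Qed.

Lemma dual_norm_ge0 n (f : 'M[dual X]_n) : 0 <= mxnorm (dual X) f.
Proof.
apply: le_trans (opnorm_amplify_le f (x := 0 : 'M[X]_0) _); last by rewrite ruan_norm0.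
apply: ub_le_sup; last by exists 0; rewrite /= ?mulmx0 l2norm0.
have [K K0 fK] := dual_bound_exists f.
by exists K => _ [v /= v1 <-]; apply: amplify_le; rewrite ?ruan_norm0.
Qed.

Lemma amplify_hs2 m n (f : 'M[dual X]_n) (x : 'M[X]_m) (v : 'cV[C]_(m * n)) :
  mxnorm X x <= 1 -> hs2 (amplify f x *m v) <= mxnorm (dual X) f ^+ 2 * hs2 v.
Proof.
move=> x1; have [v0|v0] := eqVneq (hs2 v) 0.
  have -> : v = 0 by apply: hs2_eq0; rewrite v0.
  by rewrite mulmx0 !hs2_0 mulr0.
have vp : 0 < hs2 v by rewrite lt_neqAle eq_sym v0 hs2_ge0.
have sp : 0 < Num.sqrt (hs2 v) by rewrite sqrtr_gt0.
pose s := (Num.sqrt (hs2 v))^-1; have s0 : 0 <= s by rewrite invr_ge0 ltW.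
have s2 : s ^+ 2 = (hs2 v)^-1 by rewrite exprVn sqr_sqrtr ?hs2_ge0.
pose u := s%:C *: v.
have u1 : hs2 u = 1 by rewrite hs2Z normc_real // s2 mulVf.
have : l2norm (amplify f x *m u) <= mxnorm (dual X) f.
  apply: le_trans (opnorm_amplify_le f x1); apply: ub_le_sup; last first.
    by exists u => //=; rewrite l2normE u1 sqrtr1.
  have [K K0 fK] := dual_bound_exists f.
  by exists K => _ [w /= w1 <-]; exact: amplify_le.
rewrite -ler_sqr ?nnegrE ?dual_norm_ge0 ?sqrtr_ge0 // l2normE sqr_sqrtr ?hs2_ge0 //.
by rewrite -scalemxAr hs2Z normc_real // s2 mulrC ler_pdivrMr.
Qed.

Lemma dual_bound_norm n (f : 'M[dual X]_n) : dual_bound f (mxnorm (dual X) f).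
Proof.
move=> m a x b x1; set D := mxnorm _ _.
have D0 : 0 <= D by exact: dual_norm_ge0.
have ab : 0 <= (hs2 a + hs2 b) / 2%:R by rewrite divr_ge0 ?addr_ge0 ?hs2_ge0.
rewrite -ler_sqr ?nnegrE ?normc_ge0 ?(mulr_ge0 D0 ab) //.
have := amplify_pair f x a^T b; rewrite trmxK => <-.
apply: le_trans (cauchy_schwarz _ _) _; rewrite hs2_vec hs2_tr.
apply: le_trans (ler_wpM2l (hs2_ge0 _) (amplify_hs2 _ _ x1)) _.
rewrite -/D hs2_vec exprMn mulrCA ler_wpM2l ?sqr_ge0 //.
have := sqr_ge0 (hs2 a - hs2 b); move: (hs2 a) (hs2 b) => p q h.
have e : ((p + q) / 2%:R) ^+ 2 - p * q = (p - q) ^+ 2 / 4%:R by field.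
by rewrite -subr_ge0 e divr_ge0.
Qed.

(** The description of the dual norm on which everything below rests; the
    definition by amplifications is not used again. *)
Lemma dual_normP n (f : 'M[dual X]_n) K : 0 <= K ->
  mxnorm (dual X) f <= K <-> dual_bound f K.
Proof.
move=> K0; split=> [fK m a x b x1|]; last exact: dual_norm_le.
apply: le_trans (dual_bound_norm f _ _ x1) _.
by rewrite ler_wpM2r // divr_ge0 ?addr_ge0 ?hs2_ge0.
Qed.

(** Each axiom is read off the bound on the products a x b.  For a direct sum of f
    and g, cut a into rows and b into columns: the two bounds add up because they
    are sums of squares. *)
Lemma ruan_dual : ruan (dual X).
Proof.
split.
- by move=> n f; exact: dual_norm_ge0.
- move=> n f g; apply: dual_norm_le; first by rewrite addr_ge0 ?dual_norm_ge0.
  move=> m a x b x1; rewrite pairDl mulrDl; apply: le_trans (le_normcD _ _) _.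
  by apply: lerD; exact: dual_bound_norm.
- move=> n c f; apply: dual_norm_le; first by rewrite mulr_ge0 ?normc_ge0 ?dual_norm_ge0.
  move=> m a x b x1; rewrite pairZl normcM -mulrA ler_wpM2l ?normc_ge0 //.
  exact: dual_bound_norm.
- move=> m n f g; set K := Num.max _ _.
  have fK : mxnorm (dual X) f <= K by rewrite le_max lexx.
  have gK : mxnorm (dual X) g <= K by rewrite le_max lexx orbT.
  have K0 : 0 <= K by apply: le_trans fK; exact: dual_norm_ge0.
  apply: dual_norm_le => // k a x b x1.
  have -> : pair (block_mx f 0 0 g) (mxact a x b) =
      pair f (mxact (usubmx a) x (lsubmx b)) + pair g (mxact (dsubmx a) x (rsubmx b)).
    rewrite pair_dsum; congr (_ + _); congr pair; apply/matrixP => i j; rewrite !mxE.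
      by apply: eq_bigr => p _; apply: eq_bigr => q _; rewrite !mxE.
    by apply: eq_bigr => p _; apply: eq_bigr => q _; rewrite !mxE.
  apply: le_trans (le_normcD _ _) _.
  have h1 := (dual_normP f K0).1 fK _ (usubmx a) x (lsubmx b) x1.
  have h2 := (dual_normP g K0).1 gK _ (dsubmx a) x (rsubmx b) x1.
  apply: le_trans (lerD h1 h2) _; rewrite -mulrDr ler_wpM2l //.
  rewrite -{3}(vsubmxK a) -{3}(hsubmxK b) hs2_row_mx hs2_col_mx -mulrDl.
  by rewrite ler_pM2r ?invr_gt0 ?ltr0n // le_eqVlt; apply/orP; left; apply/eqP; ring.
- move=> m n a f b ca cb; apply: dual_norm_le; first exact: dual_norm_ge0.
  move=> k a' x b' x1.
  have := pair_act f a^T (mxact a' x b') b^T; rewrite !trmxK => <-; rewrite mxact_comp.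
  apply: le_trans (dual_bound_norm f _ _ x1) _; rewrite ler_wpM2l ?dual_norm_ge0 //.
  rewrite ler_pM2r ?invr_gt0 ?ltr0n //; apply: lerD.
    by apply: contr_mull; exact: contr_tr.
  by apply: contr_mulr; exact: contr_tr.
Qed.

End NormFormula.
End DualNorm.

(** * The Hahn-Banach theorem *)

Section HahnBanach.
Context {R : realType}.
Local Notation C := R[i].
Variables (V W : lmodType C) (p : V -> R) (j : {linear W -> V}) (phi : W -> C^o).
Hypothesis pD : forall x y, p (x + y) <= p x + p y.
Hypothesis pZ : forall a x, p (a *: x) <= normc a * p x.
Hypothesis phi_lin : scalar phi.
Hypothesis phi_le : forall w, normc (phi w) <= p (j w).

(** Graphs of real-linear functionals, on real subspaces of V, dominated by
    p.  Domination forces such a relation to be single-valued. *)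
Record dominated (G : set (V * R)) : Prop := Dominated {
  dom_lin : forall (a : R) v r w s, G (v, r) -> G (w, s) ->
    G (a%:C *: v + w, a * r + s);
  dom_le : forall v r, G (v, r) -> r <= p v }.

Let G0 : set (V * R) := [set vr | exists w, vr = (j w, complex.Re (phi w))].

Lemma Re_le_normc (x : C) : complex.Re x <= normc x.
Proof.
case: x => a b /=; apply: le_trans (ler_norm a) _.
by rewrite -sqrtr_sqr ler_wsqrtr // lerDl sqr_ge0.
Qed.

Lemma p0 : p 0 = 0.
Proof.
have := pZ 0 0; rewrite scale0r normc0 mul0r => h; apply/eqP; rewrite eq_le h /=.
by have := pD 0 0; rewrite addr0; move: (p 0) h => t; lra.
Qed.

Lemma phi0 : phi 0 = 0.
Proof. by have := phi_lin (-1) 0 0; rewrite scaler0 addr0 /= mulN1r addNr. Qed.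

Lemma dominated_base : dominated G0.
Proof.
split.
- move=> a _ _ _ _ [v [-> ->]] [w [-> ->]]; exists (a%:C *: v + w).
  rewrite linearP phi_lin; congr (_, _).
  by case: (phi v) => x y; case: (phi w) => z t /=; rewrite mul0r subr0.
- by move=> _ _ [w [-> ->]]; apply: le_trans (phi_le w); exact: Re_le_normc.
Qed.

Lemma dominated_fun G : dominated G -> forall v r s, G (v, r) -> G (v, s) -> r = s.
Proof.
move=> dG; suff h v r s : G (v, r) -> G (v, s) -> r <= s.
  by move=> v r s vr vs; apply/eqP; rewrite eq_le !(h v).
move=> vr vs; have := dom_lin dG (-1) vs vr; rewrite rmorphN scaleN1r addNr mulN1r.
by move=> /(dom_le dG); rewrite p0 addrC subr_le0.
Qed.

(** The value c at x has to satisfy r - p(v - x) <= c <= p(w + x) - s on the graph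
    G.  Subadditivity puts every lower bound below every upper bound, and c is the
    supremum of the lower ones. *)
Lemma dominated_extend G x : dominated G -> G (0, 0) ->
  exists2 G', dominated G' & G `<=` G' /\ exists c, G' (x, c).
Proof.
move=> dG G00.
pose S := [set t | exists v r, G (v, r) /\ t = r - p (v - x)].
have Sub v r w s : G (v, r) -> G (w, s) -> r - p (v - x) <= p (w + x) - s.
  move=> vr ws; have := dom_le dG (dom_lin dG 1 vr ws).
  rewrite scale1r mul1r => h; have := pD (v - x) (w + x).
  by rewrite addrACA addNr addr0; move: h; lra.
pose c := sup S.
have Sc v r : G (v, r) -> r - p (v - x) <= c.
  move=> vr; apply: ub_le_sup; last by exists v, r.
  by exists (p (0 + x) - 0) => _ [w [s [ws ->]]]; exact: Sub.
have cS w s : G (w, s) -> c <= p (w + x) - s.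
  move=> ws; apply: ge_sup; first by exists (0 - p (0 - x)), 0, 0.
  by move=> _ [v [r [vr ->]]]; exact: Sub.
exists [set vr | exists v r t, G (v, r) /\ vr = (v + t%:C *: x, r + t * c)].
  split.
  - move=> a _ _ _ _ [v [r [t [vr [-> ->]]]]] [w [s [u [ws [-> ->]]]]].
    exists (a%:C *: v + w), (a * r + s), (a * t + u); split; first exact: dom_lin.
    congr (_, _); last by ring.
    by rewrite rmorphD rmorphM scalerDr scalerDl scalerA addrACA.
  - move=> _ _ [v [r [t [vr [-> ->]]]]].
    have scA (b d : R) w : b%:C *: (d%:C *: w) = (b * d)%:C *: w :> V.
      by rewrite scalerA -rmorphM.
    have sc b : G (b%:C *: v, b * r).
      by have := dom_lin dG b vr G00; rewrite !addr0.
    have pos (b : R) w : 0 < b -> b * p ((b^-1)%:C *: w) <= p w.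
      move=> b0; rewrite -ler_pdivlMl //; apply: le_trans (pZ _ _) _.
      by rewrite normc_real // invr_ge0 ltW.
    have [t0|t0|->] := ltgtP t 0; last first.
    + by rewrite scale0r mul0r !addr0; exact: dom_le vr.
    + have := cS _ _ (sc t^-1); rewrite -(ler_pM2l t0) => h.
      have := pos t (v + t%:C *: x) t0; rewrite scalerDr scA mulVf ?gt_eqF //.
      rewrite scale1r; apply: le_trans; rewrite -lerBrDl; apply: le_trans h _.
      by rewrite mulrBr mulrA mulfV ?gt_eqF // mul1r.
    + have u0 : 0 < - t by rewrite oppr_gt0.
      have := Sc _ _ (sc (- t)^-1); rewrite -(ler_pM2l u0) => h.
      have := pos (- t) (v + t%:C *: x) u0; rewrite scalerDr scA.
      have -> : (- t)^-1 * t = -1 by rewrite invrN mulNr mulVf ?lt_eqF.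
      rewrite rmorphN1 scaleN1r; apply: le_trans.
      by move: h; rewrite mulrBr mulrA mulfV ?gt_eqF // mul1r; lra.
split=> [[v r] vr|].
  by exists v, r, 0; rewrite scale0r mul0r !addr0.
by exists c, 0, 0, 1; rewrite scale1r mul1r !add0r.
Qed.

(** The union with the base graph makes the empty chain harmless in Zorn's
    lemma. *)
Lemma dominated_max : exists2 G, dominated G & G0 `<=` G /\ forall v, exists r, G (v, r).
Proof.
have [F FP TT|G [dG Gmax]] := @Zorn_bigcup _ (fun G => dominated (G0 `|` G)).
  have [d0l d0e] := dominated_base.
  have sub A : F A -> G0 `|` A `<=` G0 `|` \bigcup_(X in F) X.
    by move=> FA z [?|?]; [left|right; exists A].
  split.
  - move=> a v r w s [vr|[A FA vr]] [ws|[B FB ws]].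
    + by left; exact: d0l.
    + by apply: (sub B) => //; apply: (dom_lin (FP _ FB)); [left|right].
    + by apply: (sub A) => //; apply: (dom_lin (FP _ FA)); [right|left].
    + have [AB|BA] := TT _ _ FA FB.
        by apply: (sub B) => //; apply: (dom_lin (FP _ FB)); right => //; exact: AB.
      by apply: (sub A) => //; apply: (dom_lin (FP _ FA)); right => //; exact: BA.
  - move=> v r [|[A FA vr]]; first exact: d0e.
    by apply: (dom_le (FP _ FA)); right.
exists (G0 `|` G) => //; split; first by left.
move=> v; apply: contrapT => nv.
have [|G' dG' [GG' [c G'c]]] := dominated_extend v dG.
  by left; exists 0; rewrite linear0 phi0.
have eG : G0 `|` G' = G' by apply/setUidPr; apply: subset_trans GG' => z; left.
apply: (Gmax G'); last by rewrite eG.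
split; first by apply: subset_trans GG' => z; right.
by move=> /(_ _ G'c) Gc; apply: nv; exists c; right.
Qed.

(** The real part of phi extends to a real-linear u, and u(v) - i u(i v) is
    complex linear.  A rotation that makes its value at v a nonnegative real number
    turns the bound on u into a bound on the modulus. *)
Theorem hahn_banach : exists psi : V -> C^o,
  [/\ scalar psi, forall v, normc (psi v) <= p v & forall w, psi (j w) = phi w].
Proof.
have [G dG [G0G Gtot]] := dominated_max.
pose u v := sval (cid (Gtot v)).
have Gu v : G (v, u v) by rewrite /u; case: cid.
have uE v r : G (v, r) -> u v = r by move=> vr; exact: dominated_fun dG _ _ _ (Gu v) vr.
have u_lin a v w : u (a%:C *: v + w) = a * u v + u w by apply: uE; exact: dom_lin.
have uD v w : u (v + w) = u v + u w by have := u_lin 1 v w; rewrite scale1r mul1r.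
have u0 : u 0 = 0 by apply: uE; apply: G0G; exists 0; rewrite linear0 phi0.
have uZ a v : u (a%:C *: v) = a * u v by have := u_lin a v 0; rewrite u0 !addr0.
pose psi v : C^o := u v -i* u ('i *: v).
have psiD v w : psi (v + w) = psi v + psi w.
  by rewrite /psi scalerDr !uD /= opprD.
have psiZ a v : psi (a *: v) = a * psi v.
  case: a => x y; have e : (x +i* y) = x%:C + y%:C * 'i :> C.
    by rewrite [LHS]complexE mulrC.
  have -> : (x +i* y) *: v = x%:C *: v + y%:C *: ('i *: v).
    by rewrite e scalerDl scalerA.
  have i2 : 'i *: ('i *: v) = - v.
    by rewrite scalerA -expr2 sqr_i scaleN1r.
  have uN w : u (- w) = - u w by rewrite -scaleN1r -(rmorphN1 (real_complex R)) uZ mulN1r.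
  rewrite psiD /psi !uZ !(scalerA 'i) ![_ * _%:C]mulrC -!scalerA !uZ i2 uN.
  by rewrite /= ; congr (_ +i* _); ring.
have psi_lin : scalar psi by move=> a v w; rewrite psiD psiZ.
exists psi; split=> // [v|w].
- have [n0|n0] := eqVneq (psi v) 0.
    rewrite n0 normc0; have := pD v ((-1) *: v).
    rewrite scaleN1r subrr p0 => h; have := pZ (-1) v; rewrite normcN normc1 mul1r scaleN1r.
    by move: h; lra.
  have nn : normc (psi v) != 0 by apply: contra n0 => /eqP/eq0_normc ->.
  pose th := (normc (psi v))%:C / psi v.
  have e : psi (th *: v) = (normc (psi v))%:C by rewrite psiZ /th mulfVK.
  have -> : normc (psi v) = complex.Re (psi (th *: v)) by rewrite e.
  rewrite /=; apply: le_trans (dom_le dG (Gu _)) _; apply: le_trans (pZ _ _) _.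
  by rewrite normcM normcV normc_real ?normc_ge0 // mulfV // mul1r.
- have re x : u (j x) = complex.Re (phi x) by apply: uE; apply: G0G; exists x.
  rewrite /psi -linearZ !re.
  have -> : phi ('i *: w) = 'i * phi w by have := phi_lin 'i w 0; rewrite phi0 !addr0.
  by case: (phi w) => a b /=; congr (_ +i* _); ring.
Qed.
End HahnBanach.

(** * The trace-class norm and the Arveson-Wittstock extension *)

Section TraceNorm.
Context {R : realType}.
Local Notation C := R[i].

Section Seminorm.
Variable X : matNormed R.
Hypothesis rX : ruan X.

(** Costs of the factorizations of z through unit balls.  Their infimum is the
    trace-class norm, with dual M_n(X^* ) = CB(X, M_n). *)
Definition trace_costs n (z : 'M[X]_n) : set R :=
  [set t | exists m (a : 'M[C]_(n, m)) (x : 'M[X]_m) (b : 'M[C]_(m, n)),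
    [/\ mxnorm X x <= 1, z = mxact a x b & t = (hs2 a + hs2 b) / 2%:R]].

Definition trace_norm n (z : 'M[X]_n) : R := inf (trace_costs z).

Lemma trace_costs_nonempty n (z : 'M[X]_n) : trace_costs z !=set0.
Proof.
pose c := mxnorm X z + 1; have c0 : 0 < c by rewrite ltr_wpDl // ruan_ge0.
exists ((hs2 (c%:C *: 1%:M : 'M[C]_n) + hs2 (1%:M : 'M[C]_n)) / 2%:R).
exists n, (c%:C *: 1%:M), (map_mx ( *:%R (c%:C^-1)) z), 1%:M; split => //.
  by rewrite ruan_normZ // normcV (normc_real (ltW c0)) ler_pdivrMl // mulr1 lerDl.
rewrite mxactZl mxact1 map_mx_scaleA mulfV ?map_mx_scale1 //.
by rewrite eq_complex /= eqxx andbT gt_eqF.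
Qed.

Lemma trace_costs_lb n (z : 'M[X]_n) : lbound (trace_costs z) 0.
Proof. by move=> _ [m [a [x [b [_ _ ->]]]]]; rewrite divr_ge0 ?addr_ge0 ?hs2_ge0. Qed.

Lemma trace_norm_le n (z : 'M[X]_n) t : trace_costs z t -> trace_norm z <= t.
Proof. by move=> zt; apply: ge_inf => //; exists 0; exact: trace_costs_lb. Qed.

Lemma le_trace_norm n (z : 'M[X]_n) c :
  (forall t, trace_costs z t -> c <= t) -> c <= trace_norm z.
Proof. by move=> h; apply: lb_le_inf => //; exact: trace_costs_nonempty. Qed.

(** Factorizations are added by placing their middle factors on a diagonal. *)
Lemma trace_normD n (y z : 'M[X]_n) : trace_norm (y + z) <= trace_norm y + trace_norm z.
Proof.
rewrite -lerBlDr; apply: le_trace_norm => s ys; rewrite lerBlDr -lerBlDl.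
apply: le_trace_norm => t zt; rewrite lerBlDl; apply: trace_norm_le.
case: ys => m [a [x [b [x1 -> ->]]]]; case: zt => m' [a' [x' [b' [x1' -> ->]]]].
exists (m + m')%N, (row_mx a a'), (block_mx x 0 0 x'), (col_mx b b'); split.
- by apply: le_trans (ruan_dsum rX _ _) _; rewrite ge_max x1.
- by rewrite mxact_block.
- by rewrite hs2_row_mx hs2_col_mx; field.
Qed.

(** The scalar c is divided between the outer factors, so that both squares grow
    by the modulus of c. *)
Lemma trace_normZ n c (z : 'M[X]_n) :
  trace_norm (map_mx ( *:%R c) z) <= normc c * trace_norm z.
Proof.
have [->|c0] := eqVneq c 0.
  rewrite normc0 mul0r map_mx_scale0; apply: trace_norm_le.
  exists 0, 0, 0, 0; split; first by rewrite ruan_norm0.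
    by apply/matrixP => i j; rewrite !mxE big_ord0.
  by rewrite !hs2_0 addr0 mul0r.
have nc : 0 < normc c.
  by rewrite lt_neqAle normc_ge0 andbT; apply: contra c0 => /eqP/esym/eq0_normc ->.
rewrite -ler_pdivrMl //; apply: le_trace_norm => _ [m [a [x [b [x1 -> ->]]]]].
rewrite ler_pdivrMl //; apply: trace_norm_le.
pose s := Num.sqrt (normc c); have s0 : s != 0 by rewrite gt_eqF // sqrtr_gt0.
have s2 : s ^+ 2 = normc c by rewrite sqr_sqrtr // ltW.
have sc0 : s%:C != 0 :> C by rewrite eq_complex /= eqxx andbT.
exists m, ((c / s%:C) *: a), x, (s%:C *: b); split => //.
  by rewrite mxactZl mxactZr map_mx_scaleA divfK.
rewrite !hs2Z normcM normcV normc_real ?sqrtr_ge0 // -/s.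
rewrite exprMn exprVn s2 expr2 mulfK ?gt_eqF //.
by field.
Qed.

Lemma dual_bound_trace_norm n (f : 'M[dual X]_n) K : 0 <= K ->
  dual_bound f K <-> forall z, normc (pair f z) <= K * trace_norm z.
Proof.
move=> K0; split=> [fK z|fK m a x b x1].
  have [K00|K00] := eqVneq K 0.
    have [t [m [a [x [b [x1 -> _]]]]]] := trace_costs_nonempty z.
    by have := fK m a x b x1; rewrite K00 !mul0r.
  have Kp : 0 < K by rewrite lt_neqAle eq_sym K00.
  rewrite -ler_pdivrMl //; apply: le_trace_norm => _ [m [a [x [b [x1 -> ->]]]]].
  by rewrite ler_pdivrMl //; exact: fK.
apply: le_trans (fK _) _; rewrite ler_wpM2l //; apply: trace_norm_le.
by exists m, a, x, b.
Qed.
End Seminorm.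

(** A factorization of j(w) through M_m(X) can be moved into M_n(Y): after
    an LQ decomposition the outer factors are invertible n x n matrices, so the
    middle factor is determined by w.  Thus the trace-class norm of Y is the
    restriction of that of X. *)
Lemma factor_transfer (X Y : matNormed R) (j : {linear Y -> X}) n (f : 'M[dual Y]_n) K
    (w : 'M[Y]_n) (rX : ruan X) t :
  (forall n (y : 'M[Y]_n), mxnorm Y y <= mxnorm X (map_mx j y)) ->
  0 <= K -> dual_bound f K -> trace_costs (map_mx j w) t -> normc (pair f w) <= K * t.
Proof.
move=> jY K0 fK [m [a [x [b [x1 e ->]]]]]; apply/ler_addgt0Pr => d d0.
(* The decompositions cost n s^2 more than a and b; this s keeps K n s^2 below d. *)
pose N : R := K * n%:R + 1; have N0 : 0 < N by rewrite ltr_wpDl // mulr_ge0.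
pose s := Num.sqrt (d / N); have s0 : 0 < s by rewrite sqrtr_gt0 divr_gt0.
have s2 : s ^+ 2 = d / N by rewrite sqr_sqrtr // divr_ge0 // ltW.
have [L [Lu Lc Lh]] := lq_factor a s0; have [M [Mu Mc Mh]] := lq_factor b^T s0.
pose y := mxact (invmx L) w (invmx M^T).
have wy : w = mxact L y M^T.
  by rewrite mxact_comp mulmxV // mulVmx ?unitmx_tr // mxact1.
have y1 : mxnorm Y y <= 1.
  apply: le_trans (jY _ _) _; rewrite map_mxact e mxact_comp; apply: le_trans x1.
  apply: (ruan_act rX _ Lc); have := contr_tr Mc; congr contr.
  by rewrite trmx_mul trmxK trmx_inv.
rewrite wy; apply: le_trans (fK _ _ _ _ y1) _.
rewrite hs2_tr Lh Mh hs2_tr s2.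
have -> : (hs2 a + n%:R * (d / N) + (hs2 b + n%:R * (d / N))) / 2%:R =
  (hs2 a + hs2 b) / 2%:R + n%:R * (d / N) by field; rewrite gt_eqF.
rewrite mulrDr lerD2l 2!mulrA -?[_ * n%:R * _]mulrA ler_pdivrMr // mulrA [leLHS]mulrC
  ler_wpM2l ?lerDl //.
exact: ltW.
Qed.

Lemma trace_norm_isometric (X Y : matNormed R) (j : {linear Y -> X}) n (f : 'M[dual Y]_n) K
    (w : 'M[Y]_n) (rX : ruan X) :
  (forall n (y : 'M[Y]_n), mxnorm Y y <= mxnorm X (map_mx j y)) ->
  0 <= K -> dual_bound f K -> normc (pair f w) <= K * trace_norm (map_mx j w).
Proof.
move=> jY K0 fK; have [K00|K00] := eqVneq K 0.
  have [t ht] := trace_costs_nonempty rX (map_mx j w).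
  by have := factor_transfer rX jY K0 fK ht; rewrite K00 !mul0r.
have Kp : 0 < K by rewrite lt_neqAle eq_sym K00.
rewrite -ler_pdivrMl //; apply: le_trace_norm => // t ht.
by rewrite ler_pdivrMl //; exact: factor_transfer ht.
Qed.

Section Entrywise.
Variables (X Y : matNormed R) (j : {linear Y -> X}) (n : nat).

Definition lift_fun (w : 'I_n -> 'I_n -> Y) : 'I_n -> 'I_n -> X := fun i k => j (w i k).

Lemma lift_fun_linear : linear lift_fun.
Proof.
move=> a v w; apply/funext => i; apply/funext => k.
by rewrite /lift_fun -[(a *: v + w) i k]/(a *: v i k + w i k) linearP.
Qed.

HB.instance Definition _ := GRing.isLinear.Build C _ _ _ lift_fun lift_fun_linear.
End Entrywise.

(** The Arveson-Wittstock extension theorem for maps into M_n.  A matrix of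
    functionals on X is one functional on M_n(X), and its norm is the norm dual to
    the trace-class norm; so the Hahn-Banach theorem applies to that norm.  The
    space M_n(X) is represented by functions, which carry a module structure. *)
Theorem dual_extension (X Y : matNormed R) (j : {linear Y -> X}) n (f : 'M[dual Y]_n)
    (rX : ruan X) (rY : ruan Y) :
  (forall n (y : 'M[Y]_n), mxnorm Y y <= mxnorm X (map_mx j y)) ->
  exists g : 'M[dual X]_n, mxnorm (dual X) g <= mxnorm (dual Y) f /\
    forall i k y, dapp (g i k) (j y) = dapp (f i k) y.
Proof.
move=> jY; set K := mxnorm (dual Y) f.
have K0 : 0 <= K by exact: dual_norm_ge0.
have fK : dual_bound f K by exact: dual_bound_norm.
pose mx (Z : matNormed R) (v : 'I_n -> 'I_n -> Z) : 'M[Z]_n := \matrix_(i, k) v i k.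
pose p (v : 'I_n -> 'I_n -> X) := K * trace_norm (mx X v).
pose phi (w : 'I_n -> 'I_n -> Y) : C^o := pair f (mx Y w).
have mxD (Z : matNormed R) (v w : 'I_n -> 'I_n -> Z) : mx Z (v + w) = mx Z v + mx Z w.
  by apply/matrixP => i k; rewrite !mxE.
have mxZ (Z : matNormed R) a (v : 'I_n -> 'I_n -> Z) :
    mx Z (a *: v) = map_mx ( *:%R a) (mx Z v).
  by apply/matrixP => i k; rewrite !mxE.
have [|||w|psi [psi_lin psi_le psi_ext]] := @hahn_banach R _ _ p (lift_fun j (n := n)) phi.
- by move=> v w; rewrite /p -mulrDr ler_wpM2l // mxD trace_normD.
- by move=> a v; rewrite /p mulrCA ler_wpM2l // mxZ trace_normZ.
- by move=> a v w; rewrite /phi mxD mxZ pairDr pairZr.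
- have -> : p (lift_fun j w) = K * trace_norm (map_mx j (mx Y w)).
    by congr (K * trace_norm _); apply/matrixP => i k; rewrite !mxE.
  exact: trace_norm_isometric.
pose unit_fun i k (x : X) : 'I_n -> 'I_n -> X :=
  fun i' k' => if (i' == i) && (k' == k) then x else 0.
have unit_lin i k a x y : unit_fun i k (a *: x + y) = a *: unit_fun i k x + unit_fun i k y.
  apply/funext => i'; apply/funext => k'.
  rewrite -[RHS]/(a *: unit_fun i k x i' k' + unit_fun i k y i' k') /unit_fun.
  by case: ifP; rewrite // scaler0 addr0.
have unit0 i k : unit_fun i k 0 = 0.
  by apply/funext => i'; apply/funext => k'; rewrite /unit_fun if_same.
have psi0 : psi 0 = 0.
  by have := psi_lin (-1) 0 0; rewrite scaler0 addr0 /= mulN1r addNr.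
have psiZ a v : psi (a *: v) = a * psi v.
  by have := psi_lin a v 0; rewrite psi0 !addr0.
have psi_sum I (r : seq I) F : psi (\sum_(l <- r) F l) = \sum_(l <- r) psi (F l).
  elim: r => [|l r IH]; first by rewrite !big_nil psi0.
  rewrite !big_cons -IH; have := psi_lin 1 (F l) (\sum_(l <- r) F l).
  by rewrite scale1r mul1r.
have bnd i k : (fun x : X => psi (unit_fun i k x)) \in @bounded_functional R X.
  apply/asboolP; split=> [a x y|]; first by rewrite unit_lin psi_lin.
  pose e (l : 'I_n) : 'cV[C]_n := delta_mx l 0.
  exists (K * ((hs2 (e i) + hs2 (e k)^T) / 2%:R)) => x.
  pose F (y : 'M[X]_1) := normc (psi (unit_fun i k (y 0 0))).
  have -> : normc (psi (unit_fun i k x)) = F (const_mx x) by rewrite /F mxE.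
  apply: ruan_homog => // [a y|y y1].
    rewrite /F mxE; have := unit_lin i k a (y 0 0) 0.
    by rewrite unit0 !addr0 => ->; rewrite psiZ normcM.
  apply: le_trans (psi_le _) _; rewrite ler_wpM2l //; apply: trace_norm_le.
  exists 1%N, (e i), y, (e k)^T; split => //.
  apply/matrixP => i' k'; rewrite !mxE !big_ord1 !mxE /unit_fun !eqxx !andbT.
  by case: (i' == i); case: (k' == k);
    rewrite ?mul1r ?mulr1 ?mul0r ?mulr0 ?scale1r ?scale0r.
have sumE I (r : seq I) (F : I -> 'I_n -> 'I_n -> X) i k :
    (\sum_(l <- r) F l) i k = \sum_(l <- r) F l i k.
  by elim/big_rec2: _ => [//|l _ v _ <-].
pose g : 'M[dual X]_n := \matrix_(i, k) (DualSort (bnd i k) : dual X).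
have gpsi z : pair g z = psi (fun i k => z i k).
  have -> : (fun i k => z i k) = \sum_i \sum_k unit_fun i k (z i k).
    apply/funext => i'; apply/funext => k'.
    rewrite sumE (bigD1 i') //= [X in _ + X]big1 => [|i ii].
      rewrite addr0 sumE (bigD1 k') //= big1 => [|k kk].
        by rewrite addr0 /unit_fun !eqxx.
      by rewrite /unit_fun eqxx eq_sym (negbTE kk).
    by rewrite sumE big1 // => k _; rewrite /unit_fun eq_sym (negbTE ii).
  rewrite psi_sum; apply: eq_bigr => i _; rewrite psi_sum; apply: eq_bigr => k _.
  by rewrite mxE.
exists g; split.
  apply/dual_normP => //; apply/dual_bound_trace_norm => // z; rewrite gpsi.
  apply: le_trans (psi_le _) _; rewrite ler_wpM2l // le_eqVlt; apply/orP; left; apply/eqP.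
  by congr trace_norm; apply/matrixP => i k; rewrite mxE.
move=> i k y; rewrite mxE /dapp /=.
pose v : 'I_n -> 'I_n -> Y := fun i' k' => if (i' == i) && (k' == k) then y else 0.
have -> : unit_fun i k (j y) = lift_fun j v.
  apply/funext => i'; apply/funext => k'; rewrite /unit_fun /lift_fun /v.
  by case: ifP; rewrite // linear0.
rewrite psi_ext /phi /pair (bigD1 i) //= [X in _ + X]big1 => [|i' ii].
  rewrite addr0 (bigD1 k) //= big1 => [|k' kk].
    by rewrite addr0 mxE /v !eqxx.
  by rewrite mxE /v eqxx (negbTE kk) dapp0r.
by rewrite big1 // => k' _; rewrite mxE /v (negbTE ii) dapp0r.
Qed.

End TraceNorm.

(** * Columns of length two *)

Section Columns.
Context {R : realType}.
Local Notation C := R[i].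

(** Compressions to submatrices padded with zeros are products with these. *)
Definition select_mx m n (c : pred 'I_m) (f : 'I_m -> 'I_n) : 'M[C]_(m, n) :=
  \matrix_(i, j) (c i && (f i == j))%:R.

Lemma select_mx_mul m n (c : pred 'I_m) (f : 'I_m -> 'I_n) (v : 'cV[C]_n) i k :
  (select_mx c f *m v) i k = if c i then v (f i) k else 0.
Proof.
rewrite mxE (bigD1 (f i)) //= big1 => [|j ji]; last first.
  by rewrite mxE eq_sym (negbTE ji) andbF mul0r.
by rewrite addr0 mxE eqxx andbT; case: (c i); rewrite ?mul1r ?mul0r.
Qed.

Lemma contr_select_mx m n (c : pred 'I_m) (f : 'I_m -> 'I_n) :
  {in c &, injective f} -> contr (select_mx c f).
Proof.
move=> finj v; rewrite /hs2.
have -> : \sum_i \sum_j normc ((select_mx c f *m v) i j) ^+ 2 =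
    \sum_(i in c) \sum_j normc (v (f i) j) ^+ 2.
  rewrite [RHS]big_mkcond; apply: eq_bigr => i _; rewrite -topredE /=; case: ifP => ci.
    by apply: eq_bigr => j _; rewrite select_mx_mul ci.
  by rewrite big1 // => j _; rewrite select_mx_mul ci normc0 expr0n.
rewrite -(big_imset (fun q => \sum_j normc (v q j) ^+ 2) finj) /=.
rewrite [leRHS](bigID (mem (f @: c))) /= lerDl; apply: sumr_ge0 => q _.
by apply: sumr_ge0 => j _; exact: sqr_ge0.
Qed.

Lemma mxact_select_mx (V : lmodType C) m n (c d : pred 'I_m) (f g : 'I_m -> 'I_n)
    (x : 'M[V]_n) :
  mxact (select_mx c f) x (select_mx d g)^T =
    \matrix_(i, j) (if c i && d j then x (f i) (g j) else 0).
Proof.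
apply/matrixP => i j; rewrite !mxE (bigD1 (f i)) //= [X in _ + X]big1 => [|k ki].
  rewrite addr0 (bigD1 (g j)) //= big1 => [|l lj].
    by rewrite !mxE !eqxx !andbT addr0; case: (c i); case: (d j);
      rewrite ?mulr1 ?mul0r ?mulr0 ?scale1r ?scale0r.
  by rewrite !mxE [g j == l]eq_sym (negbTE lj) andbF mulr0 scale0r.
by rewrite big1 // => l _; rewrite !mxE eq_sym (negbTE ki) andbF mul0r scale0r.
Qed.

(** The matrix whose norm defines the norm of the column (u, v) in C_2; its index
    pairs carry the position in the column in the second component. *)
Definition colpair (V : zmodType) n (u v : 'M[V]_n) : 'M[V]_(n * 2) :=
  \matrix_(p, q) if (mxtens_unindex q).2 == 0 then
      (if (mxtens_unindex p).2 == 0 then u else v) (mxtens_unindex p).1 (mxtens_unindex q).1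
    else 0.

Lemma colpair_map (V W : lmodType C) (T : {linear V -> W}) n (u v : 'M[V]_n) :
  map_mx T (colpair u v) = colpair (map_mx T u) (map_mx T v).
Proof.
apply/matrixP => p q; rewrite !mxE; case: ifP => _; last exact: linear0.
by case: ifP; rewrite mxE.
Qed.

Lemma C2_norm (X : matNormed R) (P : X -> X) n (x : 'M[X]_n) :
  mxnorm (C2 X) (map_mx (fun y => (P y, y - P y) : C2 X) x) =
  mxnorm X (colpair (map_mx P x) (x - map_mx P x)).
Proof.
rewrite -[LHS]/(mxnorm X (mxflatten (map_mx (@col2_mx R X)
  (map_mx (fun y => (P y, y - P y)) x)))).
congr mxnorm; apply/matrixP => p q; rewrite !mxE /=; case: ifP => _ //.
by case: ifP; rewrite !mxE.
Qed.

Lemma unindex_inj m n (p q : 'I_(m * n)) : (mxtens_unindex p).1 = (mxtens_unindex q).1 ->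
  (mxtens_unindex p).2 = (mxtens_unindex q).2 -> p = q.
Proof.
move=> e1 e2; rewrite -(mxtens_unindexK p) -(mxtens_unindexK q); congr mxtens_index.
by move: e1 e2; case: (mxtens_unindex p) => a b; case: (mxtens_unindex q) => a' b' /= -> ->.
Qed.

Lemma ord2_neq0 (s t : 'I_2) : s != 0 -> t != 0 -> s = t.
Proof. by case: s => [[|[|]]] // ?; case: t => [[|[|]]] // ? _ _; exact: val_inj. Qed.

(** Pythagorean bound: with u and v rescaled to norm one on a diagonal, the column
    is the product of that diagonal with an isometry on the left and, on the right,
    with a column that carries the weights al and be. *)
Lemma colpair_norm_le (X : matNormed R) (rX : ruan X) n (u v : 'M[X]_n) (al be : R) :
  0 < al -> 0 < be -> mxnorm X u <= al -> mxnorm X v <= be ->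
  mxnorm X (colpair u v) ^+ 2 <= al ^+ 2 + be ^+ 2.
Proof.
move=> a0 b0 ua vb.
pose r2 := al ^+ 2 + be ^+ 2; have r20 : 0 < r2 by rewrite addr_gt0 ?exprn_gt0.
pose r := Num.sqrt r2; have r0 : 0 < r by rewrite sqrtr_gt0.
have rr : r ^+ 2 = r2 by rewrite sqr_sqrtr ?ltW.
have [[a0' b0'] r0'] := (ltW a0, ltW b0, ltW r0).
pose top (p : 'I_(n * 2)) := (mxtens_unindex p).2 == 0.
pose fs (p : 'I_(n * 2)) := (mxtens_unindex p).1.
pose E0 := select_mx top fs; pose E1 := select_mx (predC top) fs.
have cE0 : contr E0.
  by apply: contr_select_mx => p q /eqP p0 /eqP q0 e; apply: unindex_inj => //;
    rewrite p0 q0.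
have cE1 : contr E1.
  by apply: contr_select_mx => p q p0 q0 e; apply: unindex_inj => //; exact: ord2_neq0.
have cA : contr (row_mx E0 E1).
  move=> w; rewrite -(vsubmxK w) mul_row_col hs2_col_mx.
  apply: le_trans (lerD (cE0 _) (cE1 _)); rewrite /hs2 -big_split.
  apply: ler_sum => p _; rewrite -big_split; apply: ler_sum => k _.
  rewrite [X in normc X]mxE !select_mx_mul /=; case: (top p) => /=.
    by rewrite addr0 lerDl sqr_ge0.
  by rewrite add0r lerDr sqr_ge0.
pose B : 'M[C]_(n + n, n * 2) := col_mx ((al / r)%:C *: E0^T) ((be / r)%:C *: E0^T).
have cB : contr B.
  move=> w; rewrite mul_col_mx hs2_col_mx -!scalemxAl !hs2Z !normc_real ?divr_ge0 //.
  rewrite -mulrDl !exprMn -mulrDl -/r2 -rr -exprMn mulfV ?gt_eqF // expr1n mul1r.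
  exact: (contr_tr cE0).
have -> : colpair u v = map_mx ( *:%R r%:C) (mxact (row_mx E0 E1)
    (block_mx (map_mx ( *:%R (al^-1)%:C) u) 0 0 (map_mx ( *:%R (be^-1)%:C) v)) B).
  have sc (t : R) : 0 < t -> r%:C * ((t / r)%:C * (t^-1)%:C) = 1 :> C.
    move=> t0; have e : r * (t / r * t^-1) = 1 by field; rewrite !gt_eqF.
    by rewrite -!rmorphM e.
  rewrite mxact_block !mxactZr !mxactZ map_mx_scaleA.
  apply/matrixP => p q; rewrite !mxact_select_mx !mxE !scalerDr !scalerA !sc // !scale1r.
  rewrite -/(top q) -/(top p) /=.
  by case: (top q); case: (top p) => /=; rewrite ?addr0 ?add0r.
rewrite ruan_normZ // normc_real // exprMn rr -/r2 -[leRHS]mulr1 ler_wpM2l ?(ltW r20) //.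
rewrite exprn_ile1 ?ruan_ge0 //; apply: le_trans (ruan_act rX _ cA cB) _.
apply: le_trans (ruan_dsum rX _ _) _;
  rewrite ge_max !ruan_normZ // !normc_real ?invr_ge0 //.
by rewrite !ler_pdivrMl // !mulr1 ua vb.
Qed.

End Columns.

(** * Adjoints, biduals and the canonical projection *)

Section Bidual.
Context {R : realType}.
Local Notation C := R[i].

Record ruan_space := RuanSpace { ruan_mat :> matNormed R; ruan_spaceP : ruan ruan_mat }.

Record ccmap (X Y : ruan_space) := CCMap {
  cc_fun :> {linear X -> Y};
  cc_le : forall n (x : 'M[X]_n), mxnorm Y (map_mx cc_fun x) <= mxnorm X x }.

Definition dual_space (X : ruan_space) : ruan_space :=
  RuanSpace (ruan_dual (ruan_spaceP X)).
Definition bidual X := dual_space (dual_space X).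
Definition tridual X := dual_space (bidual X).
Definition quadridual X := dual_space (tridual X).

Lemma vnorm_map (X Y : matNormed R) (T : X -> Y) (x : X) :
  vnorm (T x) = mxnorm Y (map_mx T (const_mx x : 'M[X]_1)).
Proof. by congr mxnorm; apply/matrixP => i k; rewrite !mxE. Qed.

Lemma cc_vnorm_le X Y (T : ccmap X Y) x : vnorm (T x) <= vnorm x.
Proof. by rewrite vnorm_map; exact: cc_le. Qed.

Section Adjoint.
Variables (X Y : ruan_space) (T : ccmap X Y).

Lemma adj_bounded (f : dual Y) : (fun x => dapp f (T x)) \in @bounded_functional R X.
Proof.
have [M M0 fM] := dual_bounded (ruan_spaceP Y) f.
apply/asboolP; split=> [a x y|]; first by rewrite linearP dappDr dappZr.
exists M => x; apply: le_trans (fM _) _; rewrite ler_wpM2l //; exact: cc_vnorm_le.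
Qed.

Definition adj_fun (f : dual Y) : dual X := DualSort (adj_bounded f).

Lemma adj_linear : linear adj_fun.
Proof. by move=> a f g; apply: dual_ext => x. Qed.

HB.instance Definition _ := GRing.isLinear.Build C (dual Y) (dual X) _ adj_fun adj_linear.

Lemma adj_le n (f : 'M[dual Y]_n) : mxnorm (dual X) (map_mx adj_fun f) <= mxnorm (dual Y) f.
Proof.
apply: dual_norm_le; first exact: ruan_spaceP; first exact/dual_norm_ge0/ruan_spaceP.
move=> m a x b x1.
have -> : pair (map_mx adj_fun f) (mxact a x b) = pair f (mxact a (map_mx T x) b).
  rewrite -map_mxact /pair; apply: eq_bigr => i _; apply: eq_bigr => k _.
  by rewrite !(mxE map_mx_key).
apply: dual_bound_norm; first exact: ruan_spaceP.
by apply: le_trans x1; exact: cc_le.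
Qed.

Definition adj : ccmap (dual_space Y) (dual_space X) :=
  @CCMap (dual_space Y) (dual_space X) adj_fun adj_le.

Lemma adjE f x : dapp (adj f) x = dapp f (T x). Proof. by []. Qed.
End Adjoint.

Section Composition.
Variables (X Y Z : ruan_space) (S : ccmap Y Z) (T : ccmap X Y).
Lemma cc_comp_le n (x : 'M[X]_n) : mxnorm Z (map_mx (S \o T) x) <= mxnorm X x.
Proof. by rewrite map_mx_comp; apply: le_trans (cc_le _ _) (cc_le _ _). Qed.
Definition cc_comp : ccmap X Z := @CCMap X Z (S \o T) cc_comp_le.
End Composition.

Lemma dapp_le (X : matNormed R) (rX : ruan X) (f : dual X) x :
  normc (dapp f x) <= vnorm f * vnorm x.
Proof.
pose F (y : 'M[X]_1) := normc (dapp f (y 0 0)).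
have -> : normc (dapp f x) = F (const_mx x) by rewrite /F mxE.
apply: ruan_homog => // [a y|y y1]; first by rewrite /F mxE dappZr normcM.
have := dual_bound_norm rX (const_mx f : 'M[dual X]_1) 1%:M 1%:M y1.
rewrite mxact1 pair_const hs2_scalar normc1 expr1n mulr1.
have e : (1%:R + 1%:R) / 2%:R = 1 :> R by field.
by rewrite e mulr1.
Qed.

Section Evaluation.
Variable X : ruan_space.

Lemma ev_bounded (x : X) : (fun f : dual X => dapp f x) \in @bounded_functional R (dual X).
Proof.
apply/asboolP; split=> //; exists (vnorm x) => f; rewrite mulrC; exact/dapp_le/ruan_spaceP.
Qed.

Definition ev_fun (x : X) : dual (dual X) := DualSort (ev_bounded x).

Lemma ev_linear : linear ev_fun.
Proof. by move=> a x y; apply: dual_ext => f;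
  rewrite /dapp /= -!/(dapp _ _) dappDr dappZr. Qed.

HB.instance Definition _ := GRing.isLinear.Build C X (dual (dual X)) _ ev_fun ev_linear.

Lemma ev_le n (x : 'M[X]_n) : mxnorm (dual (dual X)) (map_mx ev_fun x) <= mxnorm X x.
Proof.
apply: dual_norm_le; first exact/ruan_dual/ruan_spaceP; first exact/ruan_ge0/ruan_spaceP.
move=> m a f b f1.
have -> : pair (map_mx ev_fun x) (mxact a f b) = pair f (mxact a^T x b^T).
  by rewrite [RHS]pair_act !trmxK /pair; apply: eq_bigr => i _; apply: eq_bigr => k _;
    rewrite (mxE map_mx_key).
rewrite mulrC.
pose F y := normc (pair f (mxact a^T y b^T)); rewrite -/(F x).
apply: ruan_homog; first exact: ruan_spaceP.
  by move=> c y; rewrite /F mxactZ pairZr normcM.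
move=> y y1; apply: le_trans (dual_bound_norm (ruan_spaceP X) f _ _ y1) _.
rewrite !hs2_tr -[leRHS]mul1r ler_wpM2r // divr_ge0 ?addr_ge0 ?hs2_ge0 //.
Qed.

Definition ev : ccmap X (bidual X) := @CCMap X (bidual X) ev_fun ev_le.

Lemma evE x (f : dual X) : dapp (ev x) f = dapp f x. Proof. by []. Qed.
End Evaluation.

(** The canonical projection of X^*** onto the copy of X^*, with kernel the
    annihilator of X. *)
Definition canon_proj X : ccmap (tridual X) (tridual X) :=
  cc_comp (ev (dual_space X)) (adj (ev X)).

Definition canon_proj_adj X : ccmap (quadridual X) (quadridual X) := adj (canon_proj X).

Lemma canon_projE X (Phi : tridual X) (F : bidual X) :
  dapp (canon_proj X Phi) F = dapp F (adj (ev X) Phi).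
Proof. by []. Qed.

(** Both sides restrict Phi to Y and pull the result back along T, because the
    bidual of T extends T. *)
Lemma canon_proj_natural X Y (T : ccmap X Y) (Phi : tridual Y) :
  canon_proj X (adj (adj (adj T)) Phi) = adj (adj (adj T)) (canon_proj Y Phi).
Proof.
apply: dual_ext => F; rewrite adjE !canon_projE adjE; congr dapp.
apply: dual_ext => x; rewrite !adjE; congr dapp.
by apply: dual_ext => f.
Qed.

Lemma canon_proj_adj_natural X Y (T : ccmap X Y) Psi :
  adj (adj (adj (adj T))) (canon_proj_adj X Psi) =
  canon_proj_adj Y (adj (adj (adj (adj T))) Psi).
Proof.
apply: dual_ext => Phi; rewrite adjE /canon_proj_adj adjE [RHS]adjE [RHS]adjE.
by congr dapp; exact: canon_proj_natural.
Qed.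

Lemma canon_proj_idem X Phi : canon_proj X (canon_proj X Phi) = canon_proj X Phi.
Proof. by apply: dual_ext => F; rewrite !canon_projE; congr dapp; exact: dual_ext. Qed.

Lemma canon_proj_adj_idem X Psi :
  canon_proj_adj X (canon_proj_adj X Psi) = canon_proj_adj X Psi.
Proof. by apply: dual_ext => Phi; rewrite !adjE canon_proj_idem. Qed.

Lemma canonical_imageE (X : ruan_space) : canonical_image (X := X) = range (ev X).
Proof.
apply/seteqP; split=> F [x].
  by move=> Fx; exists x => //; apply: dual_ext => f; rewrite evE /dapp Fx.
by move=> _ <-; exists x.
Qed.

(** The kernel of the canonical projection consists of the functionals that vanish
    on X, and the range of an adjoint projection is the annihilator of the kernel. *)
Lemma range_canon_proj_adj (X : ruan_space) :
  annihilator (annihilator (canonical_image (X := X))) = range (canon_proj_adj X).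
Proof.
rewrite canonical_imageE; apply/seteqP; split=> [Psi Psi0|_ [Psi _ <-] Phi Phi0].
  exists Psi => //; apply: dual_ext => Phi; rewrite adjE; apply/eqP.
  rewrite -subr_eq0 -dappBr; apply/eqP; apply: (Psi0 (_ - _)) => _ [x _ <-].
  rewrite -[LHS]/(dapp (canon_proj X Phi - Phi : dual (bidual X)) (ev X x)).
  by rewrite dappBl canon_projE subrr.
rewrite -[LHS]/(dapp (canon_proj_adj X Psi) Phi) adjE.
rewrite (_ : canon_proj X Phi = 0) ?dapp0r //; apply: dual_ext => F.
rewrite canon_projE (_ : adj (ev X) Phi = 0) ?dapp0r //; apply: dual_ext => x.
by rewrite adjE dapp0l; apply: Phi0; exists x.
Qed.

Lemma dual_norm_eq0 (X : matNormed R) (rX : ruan X) (f : dual X) : vnorm f = 0 -> f = 0.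
Proof.
move=> f0; apply: dual_ext => x; apply: eq0_normc; apply/eqP; rewrite eq_le normc_ge0 andbT.
by apply: le_trans (dapp_le rX f x) _; rewrite f0 mul0r.
Qed.

Lemma vnormZ (X : matNormed R) (rX : ruan X) (a : C) (x : X) :
  vnorm (a *: x) = normc a * vnorm x.
Proof.
by rewrite /vnorm -ruan_normZ //; congr mxnorm; apply/matrixP => i k; rewrite !mxE.
Qed.

(** A complete left M-projection P is the only contractive projection onto its
    range.  If P y = 0 and w = Q y, then t w + y has the column (t w, y), so its
    square norm is at most t^2 |w|^2 + |y|^2; but Q maps it to (t + 1) w.  For
    large t this forces w = 0. *)
Lemma left_M_projection_unique (V : ruan_space) (P : {linear V -> V}) (Q : ccmap V V) :
  (forall x : V, vnorm x = 0 -> x = 0) ->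
  complete_left_M_projection P -> (forall x, Q (Q x) = Q x) -> range P = range Q ->
  forall x, P x = Q x.
Proof.
move=> V0 [PP Piso] QQ PQ x.
have Pfix w : range Q w -> P w = w by rewrite -PQ => -[v _ <-]; exact: PP.
have QP v : Q (P v) = P v.
  have : range Q (P v) by rewrite -PQ; exists v.
  by move=> [u _ <-]; exact: QQ.
suff Q0 y : P y = 0 -> Q y = 0.
  apply/esym/eqP; rewrite -subr_eq0 -(QP x) -linearB; apply/eqP/Q0.
  by rewrite linearB PP subrr.
move=> Py0; apply: V0; set w := Q y; set W := vnorm w.
have Pw : P w = w by apply: Pfix; exists y.
have Qw : Q w = w by exact: QQ.
have W0 : 0 <= W by exact/ruan_ge0/ruan_spaceP.
apply/eqP; apply: contraT => Wn0; have Wp : 0 < W by rewrite lt_neqAle eq_sym Wn0.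
(* The summand 1 only serves to make N positive. *)
pose N := vnorm y + 1; have Np : 0 < N by rewrite ltr_wpDl //; exact/ruan_ge0/ruan_spaceP.
pose t := N ^+ 2 / W ^+ 2; have t0 : 0 < t by rewrite divr_gt0 ?exprn_gt0.
pose z := t%:C *: w + y.
have zle : vnorm z ^+ 2 <= (t * W) ^+ 2 + N ^+ 2.
  have <- : mxnorm (C2 V) (map_mx (fun y => (P y, y - P y) : C2 V) (const_mx z : 'M[V]_1)) =
      vnorm z by exact: Piso.
  have Pz : P z = t%:C *: w by rewrite linearD linearZ Pw Py0 addr0.
  rewrite C2_norm; apply: colpair_norm_le; rewrite ?(mulr_gt0 t0 Wp) //;
    first exact: ruan_spaceP.
    rewrite -vnorm_map Pz vnormZ ?normc_real ?(ltW t0) //; exact: ruan_spaceP.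
  have -> : const_mx z - map_mx P (const_mx z) = const_mx y :> 'M[V]_1.
    by apply/matrixP => i k; rewrite !mxE Pz addrAC subrr add0r.
  by rewrite -/(vnorm y) lerDl.
have zge : (t + 1) * W <= vnorm z.
  apply: le_trans (cc_vnorm_le Q z).
  rewrite linearD linearZ -/w Qw -{2}(scale1r w) -scalerDl vnormZ; last exact: ruan_spaceP.
  by rewrite -(rmorph1 (real_complex R)) -rmorphD normc_real // addr_ge0 // ltW.
have : ((t + 1) * W) ^+ 2 <= (t * W) ^+ 2 + N ^+ 2.
  apply: le_trans zle; have zge0 : 0 <= (t + 1) * W by rewrite mulr_ge0 // addr_ge0 // ltW.
  by rewrite ler_sqr ?nnegrE // (le_trans zge0).
have -> : N ^+ 2 = t * W ^+ 2 by rewrite /t divfK // expf_neq0.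
clearbody t.
rewrite !exprMn -mulrDl ler_pM2r ?exprn_gt0 //.
rewrite leNgt (_ : t ^+ 2 + t < (t + 1) ^+ 2) // -subr_gt0.
by rewrite (_ : _ - _ = t + 1) ?addr_gt0 //; ring.
Qed.

(** By uniqueness this is the only way for X to be right M-embedded.  The condition
    involves no choice of a projection and is natural in X. *)
Definition canon_isometry X : Prop :=
  @complete_isometry R (quadridual X) (C2 (quadridual X))
    (fun Psi => (canon_proj_adj X Psi, Psi - canon_proj_adj X Psi)).

Lemma canonical_image_M_summand (X : ruan_space) :
  right_M_summand (annihilator (annihilator (canonical_image (X := X)))) <->
  canon_isometry X.
Proof.
rewrite range_canon_proj_adj; split=> [[P [PP rP]]|iso].
  have PQ Psi : P Psi = canon_proj_adj X Psi.
    apply: (@left_M_projection_unique (quadridual X)) => // [Phi|Phi].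
      exact/dual_norm_eq0/ruan_spaceP.
    exact: canon_proj_adj_idem.
  have [_ iso] := PP => n x; rewrite -[RHS](iso n x).
  by congr mxnorm; apply/matrixP => i k; rewrite !mxE PQ.
exists (canon_proj_adj X : {linear quadridual X -> quadridual X}); split => //.
by split => // Psi; exact: canon_proj_adj_idem.
Qed.

End Bidual.

(** * Transfer of the criterion to subspaces and quotients *)

Section Transfer.
Context {R : realType}.
Local Notation C := R[i].

Definition isometric (X Y : ruan_space (R := R)) (T : ccmap X Y) : Prop :=
  forall n (x : 'M[X]_n), mxnorm Y (map_mx T x) = mxnorm X x.

(** Complete quotient maps, for T a complete contraction: at every matrix level the
    open unit ball is mapped onto the open unit ball. *)
Definition quotient_map (X Y : ruan_space (R := R)) (T : ccmap X Y) : Prop :=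
  forall n (z : 'M[Y]_n) (e : R), 0 < e ->
    exists2 x, map_mx T x = z & mxnorm X x <= mxnorm Y z + e.

Lemma adj_isometric X Y (T : ccmap X Y) : isometric T -> quotient_map (adj T).
Proof.
move=> iT n f e e0.
have [n' y|g [gf gT]] := dual_extension (j := T) f (ruan_spaceP Y) (ruan_spaceP X).
  by rewrite iT.
exists g; first by apply/matrixP => i k; rewrite (mxE map_mx_key); apply: dual_ext => x;
  rewrite adjE gT.
by apply: le_trans gf _; rewrite lerDl ltW.
Qed.

Lemma pair_le (X : matNormed R) (rX : ruan X) m n (f : 'M[dual X]_n)
    (a : 'M[C]_(n, m)) x b :
  normc (pair f (mxact a x b)) <= mxnorm (dual X) f * ((hs2 a + hs2 b) / 2%:R) * mxnorm X x.
Proof.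
pose F y := normc (pair f (mxact a y b)); rewrite -/(F x).
apply: ruan_homog => // [c y|y y1]; first by rewrite /F mxactZ pairZr normcM.
exact: dual_bound_norm.
Qed.

Lemma adj_quotient X Y (T : ccmap X Y) : quotient_map T -> isometric (adj T).
Proof.
move=> qT n f; apply/eqP; rewrite eq_le cc_le andTb.
set K := mxnorm _ (map_mx (adj T) f); have K0 : 0 <= K by exact/ruan_ge0/ruan_spaceP.
apply: dual_norm_le => //; first exact: ruan_spaceP.
move=> m a y b y1; set h := _ / _.
have h0 : 0 <= h by rewrite divr_ge0 ?addr_ge0 ?hs2_ge0.
have Kh : 0 <= K * h by rewrite mulr_ge0.
apply/ler_addgt0Pr => e e0; pose d := e / (K * h + 1).
have d0 : 0 < d by rewrite divr_gt0 // ltr_wpDl.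
have [x xy xd] := qT _ y d d0.
have -> : pair f (mxact a y b) = pair (map_mx (adj T) f) (mxact a x b).
  rewrite -xy -map_mxact /pair; apply: eq_bigr => i _; apply: eq_bigr => k _.
  by rewrite !(mxE map_mx_key).
apply: le_trans (pair_le (ruan_spaceP X) _ _ _ _) _; rewrite -/h -/K.
apply: (@le_trans _ _ (K * h * (1 + d)));
  first by rewrite ler_wpM2l // (le_trans xd) // lerD2r.
rewrite mulrDr mulr1 lerD2l /d mulrA ler_pdivrMr ?ltr_wpDl // mulrC.
by rewrite ler_wpM2l ?(ltW e0) // lerDl.
Qed.

(** The fourfold adjoint of an isometric T is isometric and intertwines the canonical
    projections, so it carries the norms of columns over. *)
Lemma canon_isometry_sub X Y (T : ccmap Y X) :
  isometric T -> canon_isometry X -> canon_isometry Y.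
Proof.
move=> iT isoX n Psi.
have i4 : isometric (adj (adj (adj (adj T)))).
  exact/adj_quotient/adj_isometric/adj_quotient/adj_isometric.
rewrite C2_norm -(i4 _ Psi) -[RHS](isoX n) C2_norm -[LHS](i4 _) colpair_map.
have e : map_mx (adj (adj (adj (adj T)))) (map_mx (canon_proj_adj Y) Psi) =
   map_mx (canon_proj_adj X) (map_mx (adj (adj (adj (adj T)))) Psi).
  by apply/matrixP => i k; rewrite !(mxE map_mx_key) canon_proj_adj_natural.
by rewrite map_mxB e.
Qed.

(** One inequality follows by lifting Psi.  For the other one, write Q for the
    canonical projection and lift the column (Q Psi, Psi - Q Psi) to w.  Let a and b
    be the two blocks in the first column of w.  Then S = Q a + (b - Q b) lifts Psi,
    and its column (Q S, S - Q S) = (Q a, b - Q b) is a compression of the column of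
    w, whose norm is that of w. *)
Lemma canon_isometry_quotient X Y (T : ccmap X Y) :
  quotient_map T -> canon_isometry X -> canon_isometry Y.
Proof.
move=> qT isoX n Psi.
pose q := adj (adj (adj (adj T))).
have q4 : quotient_map q.
  exact/adj_isometric/adj_quotient/adj_isometric/adj_quotient.
have qQ m (x : 'M[quadridual X]_m) : map_mx q (map_mx (canon_proj_adj X) x) =
    map_mx (canon_proj_adj Y) (map_mx q x).
  by apply/matrixP => i k; rewrite !(mxE map_mx_key) canon_proj_adj_natural.
have Xcol m (x : 'M[quadridual X]_m) :
    mxnorm _ (colpair (map_mx (canon_proj_adj X) x) (x - map_mx (canon_proj_adj X) x)) =
      mxnorm _ x.
  by rewrite -(isoX m) C2_norm.
rewrite C2_norm; apply/eqP; rewrite eq_le; apply/andP; split.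
  apply/ler_addgt0Pr => e e0; have [x xPsi xe] := q4 _ Psi e e0.
  apply: le_trans xe; rewrite -xPsi -qQ -map_mxB -colpair_map -[leRHS]Xcol.
  exact: (cc_le q).
set Q := canon_proj_adj X in qQ Xcol *; set col := colpair _ _.
apply/ler_addgt0Pr => e e0; have [w wcol we] := q4 _ col e e0.
apply: le_trans we.
pose top (p : 'I_(n * 2)) := (mxtens_unindex p).2 == 0.
pose s0 : 'I_2 := 0.
pose s1 : 'I_2 := 1.
pose a : 'M[quadridual X]_n :=
  \matrix_(i, k) w (mxtens_index (i, s0)) (mxtens_index (k, s0)).
pose b : 'M[quadridual X]_n :=
  \matrix_(i, k) w (mxtens_index (i, s1)) (mxtens_index (k, s0)).
pose S := map_mx Q a + (b - map_mx Q b).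
have qa : map_mx q a = map_mx (canon_proj_adj Y) Psi.
  apply/matrixP => i k; have := congr1 (fun M : 'M[quadridual Y]_(n * 2) =>
    M (mxtens_index (i, s0)) (mxtens_index (k, s0))) wcol.
  by rewrite !(mxE map_mx_key) /col (mxE matrix_key) !mxtens_indexK /= (mxE map_mx_key)
    (mxE matrix_key).
have qb : map_mx q b = Psi - map_mx (canon_proj_adj Y) Psi.
  apply/matrixP => i k; have := congr1 (fun M : 'M[quadridual Y]_(n * 2) =>
    M (mxtens_index (i, s1)) (mxtens_index (k, s0))) wcol.
  by rewrite !(mxE map_mx_key) /col (mxE matrix_key) !mxtens_indexK /= (mxE matrix_key).
have QQ (V : ruan_space) m (x : 'M[quadridual V]_m) :
    map_mx (canon_proj_adj V) (map_mx (canon_proj_adj V) x) = map_mx (canon_proj_adj V) x.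
  by apply/matrixP => i k; rewrite !(mxE map_mx_key) canon_proj_adj_idem.
have qS : map_mx q S = Psi.
  rewrite /S map_mxD map_mxB !qQ qa qb map_mxB !QQ subrr subr0 addrC; exact: subrK.
have QS : map_mx Q S = map_mx Q a by rewrite /S map_mxD map_mxB !QQ subrr addr0.
rewrite -qS; apply: le_trans (cc_le q _) _; rewrite -(Xcol _ S) QS.
have -> : S - map_mx Q a = b - map_mx Q b by rewrite /S addrAC subrr add0r.
rewrite -[leRHS](Xcol _ w); set W := colpair (map_mx Q w) _.
pose row_sel (p : 'I_(n * 2)) : 'I_(n * 2 * 2) := mxtens_index (p, (mxtens_unindex p).2).
pose col_sel (p : 'I_(n * 2)) : 'I_(n * 2 * 2) := mxtens_index (p, s0).
have -> : colpair (map_mx Q a) (b - map_mx Q b) =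
    mxact (select_mx predT row_sel) W (select_mx top col_sel)^T.
  rewrite mxact_select_mx; apply/matrixP => p r.
  rewrite mxE [RHS]mxE mxE !mxtens_indexK /= -/(top r); case: ifP => // /eqP r0.
  have pE : p = mxtens_index ((mxtens_unindex p).1, (mxtens_unindex p).2).
    by apply: unindex_inj; rewrite mxtens_indexK.
  have rE : r = mxtens_index ((mxtens_unindex r).1, s0).
    by apply: unindex_inj; rewrite mxtens_indexK.
  have wE s : (mxtens_unindex p).2 = s ->
      w p r = w (mxtens_index ((mxtens_unindex p).1, s))
        (mxtens_index ((mxtens_unindex r).1, s0)).
    by move=> <-; rewrite -pE -rE.
  case: ifP => p0.
    by rewrite [RHS](mxE map_mx_key) (wE _ (eqP p0)) !(mxE map_mx_key) (mxE matrix_key).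
  have p1 : (mxtens_unindex p).2 = s1 by apply: ord2_neq0; rewrite ?p0.
  have -> : (w - map_mx Q w) p r = w p r - Q (w p r) by rewrite !mxE.
  by rewrite (wE _ p1) !mxE.
apply: ruan_act; first exact: ruan_spaceP.
  by apply: contr_select_mx => p r _ _ /(congr1 (@mxtens_unindex _ _));
    rewrite !mxtens_indexK => -[].
by apply: contr_tr; apply: contr_select_mx => p r _ _ /(congr1 (@mxtens_unindex _ _));
  rewrite !mxtens_indexK => -[].
Qed.

End Transfer.

(** * Right M-embedded operator spaces *)

Section Completeness.
Context {R : realType}.
Local Notation C := R[i].

Section Vnorm.
Variable X : matNormed R.
Hypothesis rX : ruan X.

Lemma vnorm_ge0 (x : X) : 0 <= vnorm x. Proof. exact: ruan_ge0. Qed.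

Lemma vnormD (x y : X) : vnorm (x + y) <= vnorm x + vnorm y.
Proof.
rewrite /vnorm (_ : const_mx (x + y) = const_mx x + const_mx y :> 'M[X]_1) ?ruanD //.
by apply/matrixP => i k; rewrite !mxE.
Qed.

Lemma vnormN (x : X) : vnorm (- x) = vnorm x.
Proof. by rewrite -scaleN1r vnormZ // normcN normc1 mul1r. Qed.

Lemma vnormB (x y : X) : vnorm (x - y) = vnorm (y - x).
Proof. by rewrite -vnormN opprB. Qed.

Lemma vnorm_dist (x y z : X) : vnorm (x - z) <= vnorm (x - y) + vnorm (y - z).
Proof. by apply: le_trans (vnormD _ _); rewrite addrA subrK. Qed.

Lemma norm_cvgP (u : nat -> X) (l : X) :
  norm_cvg u l <->
  forall e : R, 0 < e -> exists N, forall n, (N <= n)%N -> vnorm (u n - l) < e.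
Proof.
split=> [ul e e0|ul].
  have /cvgrPdist_lt /(_ e e0) [N _ h] := ul; exists N => n Nn.
  by have := h n Nn; rewrite /= sub0r normrN ger0_norm // vnorm_ge0.
apply/cvgrPdist_lt => e e0; have [N h] := ul e e0; exists N => // n Nn.
by rewrite /= sub0r normrN ger0_norm ?vnorm_ge0 // h.
Qed.

Lemma vnorm_entry n (x : 'M[X]_n) i k : vnorm (x i k) <= mxnorm X x.
Proof.
have c (l : 'I_n) : contr (select_mx predT (fun _ : 'I_1 => l) : 'M[C]_(1, n)).
  by apply: contr_select_mx => p q _ _ _; rewrite !ord1.
have := ruan_act rX x (c i) (contr_tr (c k)); rewrite mxact_select_mx /=.
move=> h; apply: (le_trans _ h); rewrite le_eqVlt; apply/orP; left; apply/eqP.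
  by congr mxnorm; apply/matrixP => p q; rewrite !mxE.
Qed.

Lemma ruan_dsum_eq m n (x : 'M[X]_m) (y : 'M[X]_n) :
  mxnorm X (block_mx x 0 0 y) = Num.max (mxnorm X x) (mxnorm X y).
Proof.
apply/eqP; rewrite eq_le ruan_dsum // andTb ge_max; apply/andP; split.
  have c : contr (select_mx predT (@lshift m n) : 'M[C]_(m, m + n)).
    by apply: contr_select_mx => p q _ _; exact: lshift_inj.
  have := ruan_act rX (block_mx x 0 0 y) c (contr_tr c); rewrite mxact_select_mx /=.
  move=> h; apply: (le_trans _ h); rewrite le_eqVlt; apply/orP; left; apply/eqP.
  by congr mxnorm; apply/matrixP => p q; rewrite mxE block_mxEul.
have c : contr (select_mx predT (@rshift m n) : 'M[C]_(n, m + n)).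
  by apply: contr_select_mx => p q _ _; exact: rshift_inj.
have := ruan_act rX (block_mx x 0 0 y) c (contr_tr c); rewrite mxact_select_mx /=.
move=> h; apply: (le_trans _ h); rewrite le_eqVlt; apply/orP; left; apply/eqP.
  by congr mxnorm; apply/matrixP => p q; rewrite mxE block_mxEdr.
Qed.

(** The Hahn-Banach theorem on the line spanned by x. *)
Lemma norming_functional (x : X) :
  exists2 f : dual X, vnorm f <= 1 & dapp f x = (vnorm x)%:C.
Proof.
pose j (c : C^o) : X := (c : C) *: x.
have j_lin : linear j by move=> a b c; rewrite /j scalerDl -scalerA.
pose jL : {linear C^o -> X} := HB.pack j (GRing.isLinear.Build _ _ _ _ j j_lin).
pose phi (c : C^o) : C^o := c * (vnorm x)%:C.
have [|||c|f [f_lin f_le f_ext]] := @hahn_banach R X C^o (@vnorm R X) jL phi.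
- exact: vnormD.
- by move=> a y; rewrite vnormZ.
- by move=> a b c; rewrite /phi mulrDl -mulrA.
- by rewrite /phi normcM normc_real ?vnorm_ge0 //= /j vnormZ.
have fB : f \in @bounded_functional R X.
  by apply/asboolP; split=> //; exists 1 => y; rewrite mul1r.
exists (DualSort fB : dual X).
  apply: dual_norm_le => // m a y b y1; rewrite pair_const mul1r /dapp /=.
  apply: le_trans (f_le _) _; apply: le_trans (vnorm_entry _ _ _) _.
  exact: ruan_act_hs2.
by have := f_ext 1; rewrite /= /j /phi scale1r mul1r.
Qed.

End Vnorm.

Lemma ev_vnorm (X : ruan_space (R := R)) (x : X) : vnorm x <= vnorm (ev X x).
Proof.
have [f f1 fx] := norming_functional (ruan_spaceP X) x.
have := dapp_le (ruan_dual (ruan_spaceP X)) (ev X x) f.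
rewrite evE fx normc_real ?vnorm_ge0 //; last exact: ruan_spaceP.
move=> h; apply: le_trans h _; rewrite -[leRHS]mulr1 ler_wpM2l //.
exact/vnorm_ge0/ruan_dual/ruan_dual/ruan_spaceP.
Qed.

(** The canonical map is isometric, so its range is complete. *)
Lemma canonical_image_closed (X : ruan_space (R := R)) :
  operator_space X -> norm_closed (canonical_image (X := X)).
Proof.
move=> oX u l; rewrite canonical_imageE => uX /norm_cvgP ul.
have rB : ruan (dual (dual X)) by exact/ruan_dual/ruan_dual/ruan_spaceP.
have {}ul := ul rB.
have [x xu] : exists x, forall n, ev X (x n) = u n.
  exists (fun n => sval (cid2 (uX n))) => n; by case: cid2.
have xC : norm_cauchy x.
  move=> e e0; have [|N h] := ul (e / 2%:R); first by rewrite divr_gt0.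
  exists N => m n Nm Nn; apply: le_lt_trans (ev_vnorm _) _.
  rewrite linearB !xu; apply: le_lt_trans (vnorm_dist rB _ l _) _.
  rewrite [ltRHS]splitr; apply: ltrD; first exact: h.
  by rewrite (vnormB rB); exact: h.
have [y /(norm_cvgP (ruan_spaceP X)) xy] := norm_complete oX xC.
exists y => //; apply/eqP; rewrite -subr_eq0; apply/eqP.
apply: dual_norm_eq0; first exact/ruan_dual/ruan_spaceP.
apply/eqP; rewrite eq_le vnorm_ge0 // andbT; apply/ler_addgt0Pr => e e0; rewrite add0r.
have [|N h] := ul (e / 2%:R); first by rewrite divr_gt0.
have [|M k] := xy (e / 2%:R); first by rewrite divr_gt0.
pose n := maxn N M; apply: le_trans (vnorm_dist rB _ (u n) _) _.
rewrite [leRHS]splitr; apply: lerD; last by apply/ltW/h; rewrite leq_maxl.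
rewrite (vnormB rB) -xu -linearB; apply: le_trans (cc_vnorm_le (ev X) _) _.
by apply/ltW/k; rewrite leq_maxr.
Qed.

Lemma right_M_embeddedP (X : ruan_space (R := R)) : operator_space X ->
  right_M_embedded X <-> canon_isometry X.
Proof.
move=> oX; split=> [[_ [_ _ /canonical_image_M_summand]]//|iso].
split => //; split; last exact/canonical_image_M_summand.
  rewrite canonical_imageE; split=> [|a F G]; first by rewrite inE; exists 0;
    rewrite ?linear0.
  rewrite !inE => -[x _ <-] [y _ <-]; exists (a *: x + y) => //; exact: linearP.
exact: canonical_image_closed.
Qed.

End Completeness.

(** * Subspaces and quotients as operator spaces *)

Section SubQuotient.
Context {R : realType}.
Local Notation C := R[i].
Variables (X : matNormed R) (Y : linear_subspace X).
Hypothesis oX : operator_space X.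
Let rX := operator_space_ruan oX.
Hypothesis Y_closed : norm_closed [set` Y].

Lemma sub_val_linear : linear (@sub_val R X Y : sub_space Y -> X).
Proof. by []. Qed.

HB.instance Definition _ := GRing.isLinear.Build C (sub_space Y) X _ _ sub_val_linear.

Lemma sub_val_inj n : injective
  (map_mx (@sub_val R X Y : sub_space Y -> X) : 'M[sub_space Y]_n -> 'M[X]_n).
Proof.
move=> x y /matrixP xy; apply/matrixP => i k; apply: val_inj.
by have := xy i k; rewrite !mxE.
Qed.

Lemma operator_space_sub : operator_space (sub_space Y).
Proof.
split.
- move=> n x x0; apply: sub_val_inj; rewrite (mxnorm_eq0 oX x0).
  by apply/matrixP => i k; rewrite !mxE.
- move=> n x y; rewrite /mxnorm /= map_mxD; exact: mxnorm_triangle.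
- move=> n a x; rewrite /mxnorm /= -(mxnormZ oX); congr mxnorm.
  by apply/matrixP => i k; rewrite !mxE.
- move=> m n x y; rewrite /mxnorm /= map_block_mx !raddf0; exact: mxnorm_dsum.
- move=> m n a x b;
    rewrite /mxnorm /= (map_mxact (@sub_val R X Y : {linear sub_space Y -> X})).
  exact: mxnorm_act.
- move=> u uC.
  have vE (y : sub_space Y) : vnorm y = vnorm (sub_val y) by exact/esym/vnorm_map.
  have [e e0|l ul] := norm_complete oX (u := fun n => sub_val (u n)).
    have [N h] := uC e e0; exists N => m n Nm Nn; have := h m n Nm Nn.
    by rewrite vE.
  have lY : l \in subspace_pred Y.
    by apply: (Y_closed _ ul) => n; exact: sub_valP.
  by exists (SubSort lY); rewrite /norm_cvg; under eq_fun do rewrite vE.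
Qed.

Lemma quot_pi_linear : linear (@quot_pi R X Y : X -> quot_space Y).
Proof. by move=> a x y; rewrite quot_piD -quot_scaleE. Qed.

HB.instance Definition _ := GRing.isLinear.Build C X (quot_space Y) _ _ quot_pi_linear.

Let q : {linear X -> quot_space Y} := @quot_pi R X Y.

Lemma quot_le n (x : 'M[X]_n) : mxnorm (quot_space Y) (map_mx q x) <= mxnorm X x.
Proof.
apply: ge_inf; last by exists x.
by exists 0 => _ [y _ <-]; exact: ruan_ge0.
Qed.

Lemma quot_lift n (z : 'M[quot_space Y]_n) (e : R) : 0 < e ->
  exists2 x, map_mx q x = z & mxnorm X x <= mxnorm (quot_space Y) z + e.
Proof.
move=> e0; pose S := [set mxnorm X x | x in [set x : 'M[X]_n | map_mx q x = z]].
have S0 : S !=set0.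
  exists (mxnorm X (map_mx repr z)), (map_mx repr z) => //=.
  by apply/matrixP => i k; rewrite !mxE; exact: quot_reprK.
have [|_ [x xz <-] xe] := @inf_adherent _ S e e0.
  by split => //; exists 0 => _ [y _ <-]; exact: ruan_ge0.
by exists x => //; exact: ltW.
Qed.

Lemma ruan_quot : ruan (quot_space Y).
Proof.
have ge0 n (z : 'M[quot_space Y]_n) : 0 <= mxnorm (quot_space Y) z.
  apply: lb_le_inf.
    exists (mxnorm X (map_mx repr z)), (map_mx repr z) => //=.
    by apply/matrixP => i k; rewrite !mxE; exact: quot_reprK.
  by move=> _ [y _ <-]; exact: ruan_ge0.
split => //.
- move=> n y z; apply/ler_addgt0Pr => e e0; have e2 : 0 < e / 2%:R by rewrite divr_gt0.
  have [x <- xe] := quot_lift y e2; have [x' <- xe'] := quot_lift z e2.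
  rewrite -map_mxD; apply: le_trans (quot_le _) _; apply: le_trans (ruanD rX _ _) _.
  by rewrite [e]splitr addrACA; exact: lerD.
- move=> n a z; apply/ler_addgt0Pr => e e0.
  have a1 : 0 < normc a + 1 by rewrite ltr_wpDl // normc_ge0.
  have d0 : 0 < e / (normc a + 1) by rewrite divr_gt0.
  have [x xz xe] := quot_lift z d0.
  have -> : map_mx ( *:%R a) z = map_mx q (map_mx ( *:%R a) x).
    by rewrite -xz; apply/matrixP => i k; rewrite !(mxE map_mx_key) linearZ.
  apply: le_trans (quot_le _) _; rewrite ruan_normZ //.
  apply: le_trans (ler_wpM2l (normc_ge0 _) xe) _; rewrite mulrDr lerD2l.
  by rewrite mulrA ler_pdivrMr // mulrC ler_wpM2l ?(ltW e0) // lerDl.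
- move=> m n y z; apply/ler_addgt0Pr => e e0.
  have [x xy xe] := quot_lift y e0; have [x' xz xe'] := quot_lift z e0.
  have -> : block_mx y 0 0 z = map_mx q (block_mx x 0 0 x').
    by rewrite map_block_mx xy xz !raddf0.
  apply: le_trans (quot_le _) _; apply: le_trans (ruan_dsum rX _ _) _.
  rewrite ge_max (le_trans xe) ?(le_trans xe') // lerD2r le_max lexx ?orbT //.
- move=> m n a z b ca cb; apply/ler_addgt0Pr => e e0.
  have [x <- xe] := quot_lift z e0; rewrite -map_mxact.
  by apply: le_trans (quot_le _) _; apply: le_trans xe; exact: ruan_act.
Qed.

(** A subsequence of u whose steps are less than 2^-k lifts to a Cauchy sequence of
    partial sums, and the image of its limit is the limit of u. *)
Lemma quot_complete (u : nat -> quot_space Y) : norm_cauchy u -> exists l, norm_cvg u l.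
Proof.
move=> uC.
have lift (z : quot_space Y) (e : R) : vnorm z < e -> exists2 x, q x = z & vnorm x < e.
  move=> ze; have d0 : 0 < (e - vnorm z) / 2%:R by rewrite divr_gt0 // subr_gt0.
  have [x xz xe] := quot_lift (const_mx z : 'M[quot_space Y]_1) d0; exists (x 0 0).
    by have /matrixP /(_ 0 0) := xz; rewrite !mxE.
  apply: le_lt_trans (vnorm_entry rX _ _ _) _; apply: le_lt_trans xe _.
  by rewrite -/(vnorm z); move: ze; lra.
pose ep k : R := (2%:R ^+ k)^-1; have ep0 k : 0 < ep k by rewrite invr_gt0 exprn_gt0.
have epS k : ep k = ep k.+1 + ep k.+1 by rewrite [LHS]splitr /ep exprS invfM mulrC.
have [N hN] : exists N : nat -> nat, forall k m n, (N k <= m)%N -> (N k <= n)%N ->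
    vnorm (u m - u n) < ep k.
  by have /choice[N hN] := fun k => uC _ (ep0 k); exists N.
(* The sum is an increasing bound for N. *)
pose idx k := (\sum_(i < k.+1) N i)%N.
have Nidx k : (N k <= idx k)%N by rewrite /idx big_ord_recr leq_addl.
have idxS k : (idx k <= idx k.+1)%N by rewrite /idx [leqRHS]big_ord_recr leq_addr.
have hd k : exists2 x, q x = u (idx k.+1) - u (idx k) & vnorm x < ep k.
  by apply: lift; apply: hN; rewrite // (leq_trans (Nidx k)).
pose d k := sval (cid2 (hd k)).
have dq k : q (d k) = u (idx k.+1) - u (idx k) by rewrite /d; case: cid2.
have dle k : vnorm (d k) < ep k by rewrite /d; case: cid2.
pose x k := repr (u (idx 0%N)) + \sum_(i < k) d i : X.
have xS k : x k.+1 = x k + d k by rewrite /x big_ord_recr addrA.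
have xq k : q (x k) = u (idx k).
  elim: k => [|k IH]; first by rewrite /x big_ord0 addr0; exact: quot_reprK.
  by rewrite xS linearD IH dq addrC subrK.
have xdist k m : vnorm (x (k + m)%N - x k) <= ep k + ep k - (ep (k + m)%N + ep (k + m)%N).
  elim: m => [|m IH].
    by rewrite addn0 !subrr -(scale0r 0) vnormZ // normc0 mul0r.
  rewrite addnS; apply: le_trans (vnorm_dist rX _ (x (k + m)%N) _) _.
  have -> : x (k + m).+1 - x (k + m)%N = d (k + m)%N by rewrite xS addrAC subrr add0r.
  apply: le_trans (lerD (ltW (dle _)) IH) _.
  by rewrite -epS; move: (ep (k + m)%N) (ep k) => a b; lra.
have xd k m : (k <= m)%N -> vnorm (x m - x k) <= ep k + ep k.
  move=> km; rewrite -(subnKC km); apply: le_trans (xdist _ _) _.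
  by rewrite gerBl addr_ge0 // ltW.
have small (M : nat) (e : R) : 0 < e -> exists2 k, (M <= k)%N & ep k < e.
  move=> e0; exists (M + Num.bound e^-1)%N; first exact: leq_addr.
  rewrite invf_plt ?posrE ?exprn_gt0 //; have ei : 0 <= e^-1 by rewrite invr_ge0 ltW.
  apply: lt_le_trans (archi_boundP ei) _; rewrite -natrX ler_nat.
  by apply: leq_trans (ltnW (ltn_expl _ _)) => //; exact: leq_addl.
have xC : norm_cauchy x.
  move=> e e0; have [|k _ ke] := small 0 (e / 4%:R); first by rewrite divr_gt0.
  exists k => m n km kn; apply: le_lt_trans (vnorm_dist rX _ (x k) _) _.
  have := xd _ _ km; have := xd _ _ kn; rewrite (vnormB rX (x n)).
  by move: (vnorm _) (vnorm _) (ep k) ke => a b c; lra.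
have [l /(norm_cvgP rX) xl] := norm_complete oX xC.
exists (q l); apply/(norm_cvgP ruan_quot) => e e0.
have e2 : 0 < e / 2%:R by rewrite divr_gt0.
have [M hM] := xl _ e2; have [k Mk ke] := small M _ e2.
exists (idx k) => n kn; apply: le_lt_trans (vnorm_dist ruan_quot _ (u (idx k)) _) _.
rewrite [e]splitr; apply: ltrD.
  by apply: lt_trans ke; apply: hN => //; apply: leq_trans kn.
rewrite -xq -linearB; apply: le_lt_trans (hM _ Mk).
by rewrite vnorm_map; exact: quot_le.
Qed.

Lemma operator_space_quot : operator_space (quot_space Y).
Proof.
have rQ := ruan_quot; split.
- move=> n z z0; apply/matrixP => i k; rewrite mxE -(quot_reprK (z i k)).
  pose x0 : X := repr (z i k); rewrite -/x0.
  (* Small lifts x exhibit x0 as a limit of elements x0 - x of Y. *)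
  have h m : exists2 x, q x = z i k & vnorm x <= m.+1%:R^-1.
    have [x xz xe] := quot_lift z (ltac:(by rewrite invr_gt0) : 0 < m.+1%:R^-1 :> R).
    exists (x i k); first by rewrite -xz mxE.
    by apply: le_trans (vnorm_entry rX _ _ _) _; rewrite z0 add0r in xe.
  pose x m := sval (cid2 (h m)).
  have xq m : q (x m) = z i k by rewrite /x; case: cid2.
  have xle m : vnorm (x m) <= m.+1%:R^-1 by rewrite /x; case: cid2.
  suff x0Y : x0 \in subspace_pred Y.
    by rewrite -(linear0 q); apply/quot_piP; rewrite subr0.
  apply: (Y_closed (u := fun m => x0 - x m)) => [m|].
    by apply/quot_piP; rewrite quot_reprK -(xq m).
  apply/(norm_cvgP rX) => e e0; exists (Num.bound e^-1) => m hm.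
  rewrite addrAC subrr add0r vnormN //; apply: le_lt_trans (xle m) _.
  rewrite invf_plt ?posrE ?ltr0n //; have ei : 0 <= e^-1 by rewrite invr_ge0 ltW.
  by apply: lt_le_trans (archi_boundP ei) _; rewrite ler_nat ltnW.
- by move=> n y z; exact: ruanD.
- by move=> n a z; exact: ruan_normZ.
- by move=> m n y z; exact: ruan_dsum_eq.
- move=> m n a z b.
  apply/ler_addgt0Pr => e e0.
  pose t := opnorm a * opnorm b; have t0 : 0 <= t by rewrite mulr_ge0 // opnorm_ge0.
  have d0 : 0 < e / (t + 1) by rewrite divr_gt0 // ltr_wpDl.
  have [x xz xe] := quot_lift z d0; rewrite -{1}xz -map_mxact.
  apply: le_trans (quot_le _) _; apply: le_trans (mxnorm_act oX _ _ _) _.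
  rewrite mulrAC -/t; apply: le_trans (ler_wpM2l t0 xe) _.
  rewrite [X in _ <= X + _]mulrAC -/t mulrDr lerD2l mulrA ler_pdivrMr ?ltr_wpDl //.
  by rewrite mulrC ler_wpM2l ?(ltW e0) // lerDl.
- exact: quot_complete.
Qed.

Definition sub_ruan_space : ruan_space :=
  RuanSpace (operator_space_ruan operator_space_sub).
Definition quot_ruan_space : ruan_space := RuanSpace ruan_quot.
Definition ambient_ruan_space : ruan_space := RuanSpace rX.

Lemma sub_val_le n (y : 'M[sub_ruan_space]_n) :
  mxnorm ambient_ruan_space (map_mx (@sub_val R X Y :
    {linear sub_ruan_space -> ambient_ruan_space}) y) <= mxnorm sub_ruan_space y.
Proof. by []. Qed.

Definition sub_incl : ccmap sub_ruan_space ambient_ruan_space := CCMap sub_val_le.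
Definition quot_proj : ccmap ambient_ruan_space quot_ruan_space :=
  @CCMap R ambient_ruan_space quot_ruan_space q quot_le.

Lemma sub_embedded : right_M_embedded X -> right_M_embedded (sub_space Y).
Proof.
move=> /(right_M_embeddedP (X := ambient_ruan_space) oX) iX.
apply/(right_M_embeddedP (X := sub_ruan_space) operator_space_sub).
exact: (canon_isometry_sub (T := sub_incl)).
Qed.

Lemma quot_embedded : right_M_embedded X -> right_M_embedded (quot_space Y).
Proof.
move=> /(right_M_embeddedP (X := ambient_ruan_space) oX) iX.
apply/(right_M_embeddedP (X := quot_ruan_space) operator_space_quot).
by apply: (canon_isometry_quotient (T := quot_proj)) => // n z e; exact: quot_lift.
Qed.

End SubQuotient.

Theorem theorem2p6 (R : realType) (X : matNormed R) (Y : linear_subspace X)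
    (X_nonreflexive : ~ reflexive_space X)
    (X_embedded : right_M_embedded X)
    (Y_closed : norm_closed [set` Y]%classic) :
  right_M_embedded (sub_space Y) /\ right_M_embedded (quot_space Y).
Proof.
have oX := X_embedded.1.
by split; [exact: sub_embedded|exact: quot_embedded].
Qed.
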